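(* Let $n\ge 1$ be an integer, $\theta\in\mathbb{R}$, $\alpha,\gamma\in[0,2\pi)$, and let $a\in\mathbb{R}$ satisfy $\frac{n-2}{n+2}\le a<1$. Let $f_{a,\alpha}=h_{a,\alpha}+\overline{g_{a,\alpha}}$ be the harmonic mapping on $\mathbb{D}$ with $$h_{a,\alpha}(z)=\frac{\frac{z}{1+a}-\frac12 e^{i\alpha}z^2}{(1-e^{i\alpha}z)^2},\qquad g_{a,\alpha}(z)=\frac{\frac{a e^{2i\alpha}z}{1+a}-\frac12 e^{3i\alpha}z^2}{(1-e^{i\alpha}z)^2}.$$ Let $f_\gamma=h_\gamma+\overline{g_\gamma}$ be the slanted right half-plane harmonic mapping on $\mathbb{D}$, with $h_\gamma,g_\gamma$ analytic and $h_\gamma(0)=g_\gamma(0)=0$, given by $$h_\gamma(z)+e^{-2i\gamma}g_\gamma(z)=\frac{z}{1-e^{i\gamma}z}$$ with dilatation $\omega(z)=g_\gamma'(z)/h_\gamma'(z)=e^{i\theta}z^n$. Then $f_{a,\alpha}*f_\gamma\in\mathcal{S}_H^0$, and $f_{a,\alpha}*f_\gamma$ is convex in the direction $-(\alpha+\gamma)$.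
   Context: $\mathbb{D}=\{z\in\mathbb{C}:|z|<1\}$. A complex-valued harmonic function on $\mathbb{D}$ is written $f=h+\overline{g}$ with $h,g$ analytic on $\mathbb{D}$; its dilatation is $\omega=g'/h'$. $\mathcal{S}_H$ is the class of harmonic, sense-preserving, univalent (injective) mappings $f$ on $\mathbb{D}$ with $f(0)=0$ and $f_z(0)=1$; $\mathcal{S}_H^0$ is the subclass with also $f_{\bar z}(0)=0$. For analytic $\phi(z)=\sum_{k\ge1}a_kz^k$ and $\psi(z)=\sum_{k\ge1}b_kz^k$ on $\mathbb{D}$, $(\phi*\psi)(z)=\sum_{k\ge1}a_kb_kz^k$; for harmonic $f=h+\overline{g}$ and $F=H+\overline{G}$ (with $h,g,H,G$ vanishing at $0$), $f*F=h*H+\overline{g*G}$. For $\theta\in\mathbb{R}$, a domain is convex in the direction $\theta$ if its intersection with every line parallel to the line through $0$ and $e^{i\theta}$ is connected or empty; a univalent mapping of $\mathbb{D}$ is convex in the direction $\theta$ if its image is.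
   Formalization: Since $(f_{a,\alpha}*f_\gamma)_z(0)=1/(1+a)$, which is not 1 unless $a=0$, membership in $\mathcal{S}_H^0$ is stated and proved for the normalized map $(1+a)(f_{a,\alpha}*f_\gamma)$; convexity is stated for $f_{a,\alpha}*f_\gamma$ itself. *)

(* Defs.v *)
From Stdlib Require Import Reals Factorial.
From Coquelicot Require Import Coquelicot.

Open Scope R_scope.

Definition unit_disk (z : C) : Prop := Cmod z < 1.

(* e^{it} *)
Definition expi (t : R) : C := (cos t, sin t).

Definition analytic_on_disk (f : C -> C) : Prop :=
  forall z : C, unit_disk z ->
    ex_derive (K := C_AbsRing) (V := C_NormedModule) f z.

Fixpoint C_derive_n (f : C -> C) (n : nat) (z : C) : C :=
  match n with
  | O => f z
  | S m => C_derive (C_derive_n f m) z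
  end.

Definition taylor_coeff (f : C -> C) (k : nat) : C :=
  (C_derive_n f k (RtoC 0) / RtoC (INR (fact k)))%C.

(* Componentwise, since Coquelicot's [Series] is real-valued; meaningful when
   the series converges. *)
Definition C_Series (a : nat -> C) : C :=
  (Series (fun k => Re (a k)), Series (fun k => Im (a k))).

(* The sum runs over the exponents k >= 1, hence the shift. *)
Definition hadamard (phi psi : C -> C) (z : C) : C :=
  C_Series (fun k =>
    (taylor_coeff phi (S k) * taylor_coeff psi (S k) * z ^ (S k))%C).

(* The harmonic function h + conj g, given by its analytic and co-analytic
   parts. *)
Definition harmonic_of (h g : C -> C) (z : C) : C := (h z + Cconj (g z))%C.

(* (h + conj g) * (H + conj G).  The parts are determined by the harmonic
   functions once they are required to vanish at 0. *)
Definition harmonic_conv (h g H G : C -> C) : C -> C :=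
  harmonic_of (hadamard h H) (hadamard g G).

Definition harmonic_on_disk (f : C -> C) : Prop :=
  exists h g : C -> C,
    analytic_on_disk h /\ analytic_on_disk g /\
    forall z : C, unit_disk z -> f z = harmonic_of h g z.

Definition partial_x (f : C -> C) (z : C) : C :=
  (Derive (fun x => Re (f (x, Im z))) (Re z),
   Derive (fun x => Im (f (x, Im z))) (Re z)).

Definition partial_y (f : C -> C) (z : C) : C :=
  (Derive (fun y => Re (f (Re z, y))) (Im z),
   Derive (fun y => Im (f (Re z, y))) (Im z)).

(* Wirtinger derivatives f_z and f_{\bar z} *)
Definition d_z (f : C -> C) (z : C) : C :=
  ((partial_x f z - Ci * partial_y f z) / RtoC 2)%C.

Definition d_zbar (f : C -> C) (z : C) : C :=
  ((partial_x f z + Ci * partial_y f z) / RtoC 2)%C.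

(* The left-hand side is the Jacobian of f. *)
Definition sense_preserving (f : C -> C) : Prop :=
  forall z : C, unit_disk z -> Cmod (d_z f z) ^ 2 - Cmod (d_zbar f z) ^ 2 > 0.

Definition univalent (f : C -> C) : Prop :=
  forall z w : C, unit_disk z -> unit_disk w -> f z = f w -> z = w.

Definition S_H (f : C -> C) : Prop :=
  harmonic_on_disk f /\ sense_preserving f /\ univalent f /\
  f (RtoC 0) = RtoC 0 /\ d_z f (RtoC 0) = RtoC 1.

Definition S_H0 (f : C -> C) : Prop :=
  S_H f /\ d_zbar f (RtoC 0) = RtoC 0.

(* No two open sets separate E; the empty set qualifies. *)
Definition connected (E : C -> Prop) : Prop :=
  forall U V : C -> Prop,
    open U -> open V ->
    (forall z, E z -> U z \/ V z) ->
    (exists z, E z /\ U z) ->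
    (exists z, E z /\ V z) ->
    exists z, E z /\ U z /\ V z.

(* The line through w parallel to the line through 0 and e^{i theta} *)
Definition line (w : C) (theta : R) (z : C) : Prop :=
  exists t : R, z = (w + RtoC t * expi theta)%C.

Definition set_convex_in_direction (theta : R) (Omega : C -> Prop) : Prop :=
  forall w : C, connected (fun z => Omega z /\ line w theta z).

Definition convex_in_direction (theta : R) (f : C -> C) : Prop :=
  set_convex_in_direction theta
    (fun w => exists z : C, unit_disk z /\ f z = w).

Definition h_a (a alpha : R) (z : C) : C :=
  ((z / RtoC (1 + a) - RtoC (1 / 2) * expi alpha * z ^ 2)
     / (RtoC 1 - expi alpha * z) ^ 2)%C.

Definition g_a (a alpha : R) (z : C) : C :=
  ((RtoC a * expi (2 * alpha) * z / RtoC (1 + a)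
      - RtoC (1 / 2) * expi (3 * alpha) * z ^ 2)
     / (RtoC 1 - expi alpha * z) ^ 2)%C.

(* The dilatation condition g'/h' = e^{i theta} z^n is cleared of its
   denominator; h' cannot vanish on the disk, because differentiating the
   first identity gives h' (1 + e^{-2i gamma} e^{i theta} z^n)
   = 1 / (1 - e^{i gamma} z)^2. *)
Definition slanted_half_plane (n : nat) (theta gamma : R) (h g : C -> C)
  : Prop :=
  analytic_on_disk h /\ analytic_on_disk g /\
  h (RtoC 0) = RtoC 0 /\ g (RtoC 0) = RtoC 0 /\
  (forall z : C, unit_disk z ->
     (h z + expi (- 2 * gamma) * g z = z / (RtoC 1 - expi gamma * z))%C) /\
  (forall z : C, unit_disk z ->
     C_derive g z = (expi theta * z ^ n * C_derive h z)%C).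

(* Main.v *)
Require Import Defs.
From Stdlib Require Import Reals Lra Lia Factorial ClassicalEpsilon.
From Coquelicot Require Import Coquelicot.

Open Scope R_scope.

(** Convolving with [h_a] and [g_a] acts on power series as
    [A (h_a * h)(z) = h/2 + c zeta h'] and [(g_a * g)(z) = A (g/2 - c zeta g')] at
    [zeta = A z], where [A = e^{i alpha}] and [c = (1 - a) / (2 (1 + a))]; the
    hypothesis on [a] says exactly [0 < c <= 1/n].  The map [h] is a power series
    because [h' (1 + W) (1 - e^{i gamma} z)^2 = 1], [W = e^{i (theta - 2 gamma)} z^n],
    so its series can be written down.

    Put [w = e^{i (alpha + gamma)} z], [u = w / (1 - w)], which ranges over the
    half-plane [Re u > -1/2], and let
    [M = c (1 + 2 u) + (c n / 2) (1 - W) / (1 + W)], [e = (1 - c n) / 2 >= 0], with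
    [W] now taken at [zeta].  After a rotation, the analytic and co-analytic parts of
    the convolution have [u]-derivatives [P = (M + e) / (1 + W)] and
    [Q = W (e - M) / (1 + W)].  Since [Re M > 0 <= e] and [|W| < 1], [|Q| < |P|].
    Moreover [P - Q = c (1 + 2 u) + (1 - W) / (2 (1 + W))], whose real part is at least
    [c (1 + 2 Re u)], a positive constant on each vertical line.  Hence the imaginary
    part of the map increases from [-oo] to [+oo] along vertical lines, its level sets
    are graphs over [(-1/2, +oo)], and [|Q| < |P|] makes the real part strictly
    increasing along them: this is both univalence and connectedness of the slices. *)

(** * Complex derivatives *)

Notation is_C_derive := (is_derive (K := C_AbsRing) (V := C_NormedModule)).

Lemma Cmod_le_sub (z w : C) : Cmod w <= Cmod z + Cmod (w - z).
Proof. replace w with (z + (w - z))%C at 1 by ring. apply Cmod_triangle. Qed.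

(** The linearity required by the filter definition is automatic, since the candidate differential
    is multiplication by [l]. What remains is the usual estimate, used below in both directions. *)
Lemma is_C_derive_eps (f : C -> C) (z l : C) :
  is_C_derive f z l <->
  forall eps : R, 0 < eps -> exists delta : R, 0 < delta /\
    forall w : C, Cmod (w - z) < delta ->
      Cmod (f w - f z - (w - z) * l) <= eps * Cmod (w - z).
Proof.
split.
- intros [_ H] eps He.
  specialize (H z (fun P HP => HP) (mkposreal eps He)).
  destruct H as [d Hd]. exists d. split; [apply cond_pos|].
  intros w Hw. apply Hd. exact Hw.
- intros H. split; [apply is_linear_scal_l|].
  intros x Hx. assert (E : z = x) by exact (is_filter_lim_locally_unique (V := AbsRing_NormedModule C_AbsRing) z x Hx).
  rewrite <- E.
  intros eps. destruct (H eps (cond_pos eps)) as [d [Hd Hw]].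
  exists (mkposreal d Hd). intros y Hy. apply Hw. exact Hy.
Qed.

Lemma is_C_derive_const (c z : C) : is_C_derive (fun _ => c) z (RtoC 0).
Proof. apply (is_derive_const (V := C_NormedModule) c z). Qed.

Lemma is_C_derive_id (z : C) : is_C_derive (fun w => w) z (RtoC 1).
Proof.
apply is_C_derive_eps. intros eps He. exists 1. split; [lra|]. intros w _.
replace (w - z - (w - z) * 1)%C with (RtoC 0) by ring. rewrite Cmod_0.
apply Rmult_le_pos; [lra|apply Cmod_ge_0].
Qed.

Lemma is_C_derive_plus (f g : C -> C) (z k l : C) :
  is_C_derive f z k -> is_C_derive g z l ->
  is_C_derive (fun w => (f w + g w)%C) z (k + l)%C.
Proof. apply (is_derive_plus (V := C_NormedModule) f g z k l). Qed.

Lemma is_C_derive_minus (f g : C -> C) (z k l : C) :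
  is_C_derive f z k -> is_C_derive g z l ->
  is_C_derive (fun w => (f w - g w)%C) z (k - l)%C.
Proof. apply (is_derive_minus (V := C_NormedModule) f g z k l). Qed.

(** The general product rule lives in the module that [C_AbsRing] forms over itself. Its error
    estimate is convertible to the one in [C_NormedModule], so only linearity is proved again. *)
Lemma is_C_derive_mult (f g : C -> C) (z k l : C) :
  is_C_derive f z k -> is_C_derive g z l ->
  is_C_derive (fun w => (f w * g w)%C) z (k * g z + f z * l)%C.
Proof.
intros Hf Hg.
assert (H : is_derive (K := C_AbsRing) (V := AbsRing_NormedModule C_AbsRing)
  (fun w => (f w * g w)%C) z (k * g z + f z * l)%C).
{ apply (is_derive_mult (K := C_AbsRing) f g z k l).
  - destruct Hf as [_ Hf]. split; [apply is_linear_scal_l|exact Hf].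
  - destruct Hg as [_ Hg]. split; [apply is_linear_scal_l|exact Hg].
  - intros; apply Cmult_comm. }
destruct H as [_ H]. split; [apply is_linear_scal_l|exact H].
Qed.

Lemma is_C_derive_scal (c : C) (f : C -> C) (z l : C) :
  is_C_derive f z l -> is_C_derive (fun w => (c * f w)%C) z (c * l)%C.
Proof.
intros H.
replace (c * l)%C with (0 * f z + c * l)%C by ring.
apply (is_C_derive_mult (fun _ => c) f); [apply is_C_derive_const|exact H].
Qed.

Lemma is_C_derive_comp (f g : C -> C) (z k l : C) :
  is_C_derive f (g z) k -> is_C_derive g z l ->
  is_C_derive (fun w => f (g w)) z (l * k)%C.
Proof.
intros Hf Hg. apply (is_derive_comp (V := C_NormedModule) f g z k l Hf).
destruct Hg as [_ Hg]. split; [apply is_linear_scal_l|exact Hg].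
Qed.

Lemma is_C_derive_pow (n : nat) (z : C) :
  is_C_derive (fun w => (w ^ S n)%C) z (RtoC (INR (S n)) * z ^ n)%C.
Proof.
induction n as [|n IH].
- apply (is_derive_ext (V := C_NormedModule) (fun w : C => w)).
  { intros t. symmetry. exact (Cmult_1_r t). }
  replace (RtoC (INR 1) * z ^ 0)%C with (RtoC 1) by (simpl; ring).
  apply is_C_derive_id.
- apply (is_derive_ext (V := C_NormedModule) (fun w : C => (w * w ^ S n)%C)).
  { intros t. reflexivity. }
  replace (RtoC (INR (S (S n))) * z ^ S n)%C
    with (1 * z ^ S n + z * (RtoC (INR (S n)) * z ^ n))%C.
  { apply (is_C_derive_mult (fun w => w) (fun w => (w ^ S n)%C)); [apply is_C_derive_id|exact IH]. }
  rewrite (S_INR (S n)), RtoC_plus. simpl Cpow. ring.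
Qed.

Lemma is_C_derive_inv (z : C) :
  z <> 0%C -> is_C_derive Cinv z (- / (z * z))%C.
Proof.
intros Hz. assert (Hz' : 0 < Cmod z) by (apply Cmod_gt_0; exact Hz).
apply is_C_derive_eps. intros eps He.
(* The remainder is [(w - z)^2 / (w z^2)]. The first bound keeps [|w| >= |z| / 2], and with it the
   second gives [|w - z| <= eps |w| |z|^2]. *)
exists (Rmin (Cmod z / 2) (eps * (Cmod z * Cmod z * Cmod z) / 2)).
assert (0 < Cmod z * Cmod z * Cmod z) by (repeat apply Rmult_lt_0_compat; assumption).
split.
{ apply Rmin_pos; [lra|]. apply Rmult_lt_0_compat; [|lra]. apply Rmult_lt_0_compat; lra. }
intros w Hw.
assert (H1 : Cmod (w - z) < Cmod z / 2) by (eapply Rlt_le_trans; [exact Hw|apply Rmin_l]).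
assert (H2 : Cmod (w - z) < eps * (Cmod z * Cmod z * Cmod z) / 2)
  by (eapply Rlt_le_trans; [exact Hw|apply Rmin_r]).
assert (H3 : Cmod z / 2 <= Cmod w).
{ assert (T := Cmod_le_sub w z).
  replace (Cmod (z - w)) with (Cmod (w - z)) in T
    by (rewrite <- Cmod_opp; f_equal; ring). lra. }
assert (Hw0 : w <> 0%C) by (apply Cmod_gt_0; lra).
replace (/ w - / z - (w - z) * - / (z * z))%C with ((w - z) * ((w - z) / (w * (z * z))))%C
  by (field; split; assumption).
rewrite Cmod_mult, Rmult_comm. apply Rmult_le_compat_r; [apply Cmod_ge_0|].
rewrite Cmod_div, !Cmod_mult by (repeat apply Cmult_neq_0; assumption).
apply Rle_div_l; [apply Rmult_lt_0_compat; [lra|apply Rmult_lt_0_compat; lra]|].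
apply Rlt_le. eapply Rlt_le_trans; [exact H2|].
assert (0 < eps * (Cmod z * Cmod z)) by (apply Rmult_lt_0_compat; [lra|apply Rmult_lt_0_compat; lra]).
nra.
Qed.

Lemma locally_unit_disk (z : C) :
  unit_disk z -> locally (T := AbsRing_UniformSpace C_AbsRing) z unit_disk.
Proof.
unfold unit_disk. intros Hz. assert (Hd : 0 < 1 - Cmod z) by lra.
exists (mkposreal _ Hd). intros w Hw.
change (Cmod (w - z) < 1 - Cmod z) in Hw.
assert (T := Cmod_le_sub z w). lra.
Qed.

Lemma is_C_derive_ext_disk (f g : C -> C) (z l : C) :
  unit_disk z -> (forall w, unit_disk w -> f w = g w) ->
  is_C_derive f z l -> is_C_derive g z l.
Proof.
intros Hz E. apply is_derive_ext_loc.
generalize (locally_unit_disk z Hz). apply filter_imp. exact E.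
Qed.

(** Used to differentiate the functional identities satisfied by [h] and [g], which hold on the disk
    only. *)
Lemma is_C_derive_eq_disk (f g : C -> C) (z k l : C) :
  unit_disk z -> (forall w, unit_disk w -> f w = g w) ->
  is_C_derive f z k -> is_C_derive g z l -> k = l.
Proof.
intros Hz E Hf Hg.
rewrite <- (is_C_derive_unique _ _ _ Hg).
symmetry. apply is_C_derive_unique. apply (is_C_derive_ext_disk f); assumption.
Qed.

(** Cauchy-Riemann: [l * (dx + i dy)] has real part [Re l * dx - Im l * dy]. The factor [sqrt 2]
    compares the modulus with the maximum norm used by [differentiable_pt_lim]. *)
Lemma is_C_derive_re (f : C -> C) (x y : R) (l : C) :
  is_C_derive f (x, y) l ->
  differentiable_pt_lim (fun u v => Re (f (u, v))) x y (Re l) (- Im l).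
Proof.
intros H eps. assert (He : 0 < eps / sqrt 2)
  by (apply Rdiv_lt_0_compat; [apply cond_pos|apply sqrt_lt_R0; lra]).
destruct (proj1 (is_C_derive_eps f (x, y) l) H _ He) as [d [Hd Hw]].
assert (Hd' : 0 < d / sqrt 2)
  by (apply Rdiv_lt_0_compat; [exact Hd|apply sqrt_lt_R0; lra]).
exists (mkposreal _ Hd'). simpl. intros u v Hu Hv.
assert (S2 : 0 < sqrt 2) by (apply sqrt_lt_R0; lra).
assert (M := Cmod_2Rmax ((u, v) - (x, y))%C). simpl in M. fold (u - x) (v - y) in M.
assert (D : Cmod ((u, v) - (x, y)) < d).
{ eapply Rle_lt_trans; [exact M|].
  replace d with (sqrt 2 * (d / sqrt 2)) by (field; lra).
  apply Rmult_lt_compat_l; [exact S2|]. apply Rmax_lub_lt; assumption. }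
eapply Rle_trans; [|eapply Rle_trans; [exact (Hw _ D)|]].
- eapply Rle_trans; [|apply re_le_Cmod]. right. f_equal. unfold Re, Im. simpl. ring.
- eapply Rle_trans; [apply Rmult_le_compat_l; [lra|exact M]|].
  right. field. lra.
Qed.

Lemma is_C_derive_im (f : C -> C) (x y : R) (l : C) :
  is_C_derive f (x, y) l ->
  differentiable_pt_lim (fun u v => Im (f (u, v))) x y (Im l) (Re l).
Proof.
(* The imaginary part of [f] is the real part of [- i f]. *)
intros H. assert (H' := is_C_derive_scal (- Ci)%C f _ l H).
apply is_C_derive_re in H'.
replace (Im l) with (Re (- Ci * l)) by (unfold Re, Im; simpl; ring).
replace (Re l) with (- Im (- Ci * l)) by (unfold Re, Im; simpl; ring).
refine (differentiable_pt_lim_ext _ _ _ _ _ _ _ H').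
apply locally_2d_forall. intros u v. unfold Re, Im. simpl. ring.
Qed.

(** * Complex power series with polynomially bounded coefficients *)

Lemma Rabs_im_le_Cmod (c : C) : Rabs (Im c) <= Cmod c.
Proof. eapply Rle_trans; [apply Rmax_r|apply (Rmax_Cmod c)]. Qed.

Definition abs_summable (a : nat -> C) : Prop := ex_series (fun k => Cmod (a k)).

Lemma abs_summable_le (a : nat -> C) (b : nat -> R) :
  (forall k, Cmod (a k) <= b k) -> ex_series b -> abs_summable a.
Proof.
intros H. apply (ex_series_le (K := R_AbsRing) (V := R_CompleteNormedModule)).
intros k. eapply Rle_trans; [|apply H]. right. apply Rabs_pos_eq, Cmod_ge_0.
Qed.

Lemma abs_summable_re (a : nat -> C) :
  abs_summable a -> ex_series (fun k => Rabs (Re (a k))).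
Proof.
apply (ex_series_le (K := R_AbsRing) (V := R_CompleteNormedModule)).
intros k. eapply Rle_trans; [|apply re_le_Cmod]. right. apply Rabs_Rabsolu.
Qed.

Lemma abs_summable_im (a : nat -> C) :
  abs_summable a -> ex_series (fun k => Rabs (Im (a k))).
Proof.
apply (ex_series_le (K := R_AbsRing) (V := R_CompleteNormedModule)).
intros k. eapply Rle_trans; [|apply Rabs_im_le_Cmod]. right. apply Rabs_Rabsolu.
Qed.

Lemma C_Series_ext (a b : nat -> C) :
  (forall k, a k = b k) -> C_Series a = C_Series b.
Proof.
intros H. unfold C_Series. f_equal; apply Series_ext; intros k; rewrite H; reflexivity.
Qed.

Lemma C_Series_plus (a b : nat -> C) :
  abs_summable a -> abs_summable b ->
  C_Series (fun k => (a k + b k)%C) = (C_Series a + C_Series b)%C.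
Proof.
intros Ha Hb. unfold C_Series, Cplus. simpl. f_equal; rewrite <- Series_plus;
  try reflexivity; apply ex_series_Rabs;
  first [apply abs_summable_re; assumption | apply abs_summable_im; assumption].
Qed.

Lemma C_Series_scal (c : C) (a : nat -> C) :
  abs_summable a -> C_Series (fun k => (c * a k)%C) = (c * C_Series a)%C.
Proof.
intros Ha.
assert (Hr := ex_series_Rabs _ (abs_summable_re a Ha)).
assert (Hi := ex_series_Rabs _ (abs_summable_im a Ha)).
unfold C_Series, Cmult. simpl. rewrite <- !Series_scal_l.
f_equal.
- rewrite <- Series_minus; [apply Series_ext; reflexivity| |];
    apply (ex_series_scal_l (V := R_NormedModule)); assumption.
- rewrite <- Series_plus; [apply Series_ext; reflexivity| |];
    apply (ex_series_scal_l (V := R_NormedModule)); assumption.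
Qed.

Lemma C_Series_incr_1 (a : nat -> C) :
  abs_summable a -> C_Series a = (a O + C_Series (fun k => a (S k)))%C.
Proof.
intros Ha.
assert (Hr := ex_series_Rabs _ (abs_summable_re a Ha)).
assert (Hi := ex_series_Rabs _ (abs_summable_im a Ha)).
unfold C_Series, Cplus. simpl. f_equal;
  [apply (Series_incr_1 (fun k => Re (a k)))|apply (Series_incr_1 (fun k => Im (a k)))]; assumption.
Qed.

Lemma C_Series_incr_n (a : nat -> C) (n : nat) :
  (forall k, (k < n)%nat -> a k = RtoC 0) ->
  C_Series a = C_Series (fun k => a (n + k)%nat).
Proof.
intros H. unfold C_Series. f_equal;
  [apply (Series_incr_n_aux (fun k => Re (a k)))|apply (Series_incr_n_aux (fun k => Im (a k)))];
  intros k Hk; rewrite H by exact Hk; reflexivity.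
Qed.

(** The factor 2 comes from bounding the real and the imaginary sums separately; any constant would
    do for the differentiability estimate. *)
Lemma Cmod_C_Series (a : nat -> C) (b : nat -> R) :
  (forall k, Cmod (a k) <= b k) -> ex_series b ->
  Cmod (C_Series a) <= 2 * Series b.
Proof.
intros H Hb. assert (Ha := abs_summable_le a b H Hb).
assert (Hr := abs_summable_re a Ha). assert (Hi := abs_summable_im a Ha).
assert (R1 := Series_Rabs _ Hr). assert (I1 := Series_Rabs _ Hi).
assert (R2 : Series (fun k => Rabs (Re (a k))) <= Series b).
{ apply Series_le; [|exact Hb]. intros k; split; [apply Rabs_pos|].
  eapply Rle_trans; [apply re_le_Cmod|apply H]. }
assert (I2 : Series (fun k => Rabs (Im (a k))) <= Series b).
{ apply Series_le; [|exact Hb]. intros k; split; [apply Rabs_pos|].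
  eapply Rle_trans; [apply Rabs_im_le_Cmod|apply H]. }
replace (C_Series a) with
  (RtoC (Series (fun k => Re (a k))) + Ci * RtoC (Series (fun k => Im (a k))))%C
  by (apply injective_projections; simpl; ring).
eapply Rle_trans; [apply Cmod_triangle|].
rewrite Cmod_mult, Cmod_Ci, !Cmod_R. lra.
Qed.

(** Each of the [k + 1] terms of [1 + q + ... + q^k = (1 - q^(k+1)) / (1 - q)] is at least [q^k]. *)
Lemma linear_geom_le (q : R) (k : nat) :
  0 <= q < 1 -> INR (S k) * q ^ k * (1 - q) <= 1 - q ^ S k.
Proof.
intros Hq. induction k as [|k IH]; [simpl; lra|].
rewrite (S_INR (S k)).
assert (0 <= q ^ S k) by (apply pow_le; lra).
assert (q ^ S k <= 1) by (rewrite <- (pow1 (S k)); apply pow_incr; lra).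
replace (q ^ S (S k)) with (q * q ^ S k) by reflexivity.
assert (E : INR (S k) * q ^ S k * (1 - q) = q * (INR (S k) * q ^ k * (1 - q)))
  by (simpl pow; ring).
assert (q * (INR (S k) * q ^ k * (1 - q)) <= q * (1 - q ^ S k))
  by (apply Rmult_le_compat_l; lra).
nra.
Qed.

(** Induction on [m]: with [r = q^2], one factor [(k + 1) q^k] is at most [1 / (1 - q)], and the
    exponent [m] is left with ratio [q]. *)
Lemma ex_series_poly_geom (m : nat) (r : R) :
  0 <= r < 1 -> ex_series (fun k => INR (S k) ^ m * r ^ k).
Proof.
revert r. induction m as [|m IH]; intros r Hr.
- apply (ex_series_ext (V := R_NormedModule) (fun k => r ^ k)).
  { intros k. symmetry. apply Rmult_1_l. }
  apply ex_series_geom. rewrite Rabs_pos_eq; lra.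
- set (q := sqrt r).
  assert (Hq : 0 <= q < 1).
  { split; [apply sqrt_pos|]. rewrite <- sqrt_1. apply sqrt_lt_1; lra. }
  assert (E : r = q * q) by (symmetry; apply sqrt_sqrt; lra).
  apply (ex_series_le (K := R_AbsRing) (V := R_CompleteNormedModule) _
    (fun k => / (1 - q) * (INR (S k) ^ m * q ^ k))).
  2:{ apply (ex_series_scal_l (V := R_NormedModule)). apply IH. exact Hq. }
  intros k. change (Rabs (INR (S k) ^ S m * r ^ k) <= / (1 - q) * (INR (S k) ^ m * q ^ k)).
  assert (P1 : 0 <= INR (S k) ^ m * q ^ k)
    by (apply Rmult_le_pos; apply pow_le; [apply pos_INR|lra]).
  assert (P2 : 0 <= INR (S k) * q ^ k)
    by (apply Rmult_le_pos; [apply pos_INR|apply pow_le; lra]).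
  assert (L := linear_geom_le q k Hq).
  assert (0 <= q ^ S k) by (apply pow_le; lra).
  replace (INR (S k) ^ S m * r ^ k) with ((INR (S k) * q ^ k) * (INR (S k) ^ m * q ^ k))
    by (rewrite E, Rpow_mult_distr; change (INR (S k) ^ S m) with (INR (S k) * INR (S k) ^ m); ring).
  rewrite Rabs_pos_eq by (apply Rmult_le_pos; assumption).
  apply Rmult_le_compat_r; [exact P1|].
  apply Rmult_le_reg_r with (1 - q); [lra|].
  rewrite Rinv_l by lra. lra.
Qed.

(** * Coefficient sequences of polynomial growth *)

(** Such series converge on the whole disk, and the class is stable under sums, products, shifts,
    differentiation, integration and division by [1 - q z] with [|q| = 1], so no radius of
    convergence has to be tracked. [S k] keeps the bound meaningful at index 0. *)
Definition poly_bounded (a : nat -> C) : Prop :=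
  exists (K : R) (m : nat), 0 <= K /\ forall k, Cmod (a k) <= K * INR (S k) ^ m.

Lemma one_le_INR_S (k : nat) : 1 <= INR (S k).
Proof. rewrite S_INR. assert (H := pos_INR k). lra. Qed.

Lemma poly_bounded_mult (a b : nat -> C) :
  poly_bounded a -> poly_bounded b -> poly_bounded (fun k => (a k * b k)%C).
Proof.
intros [K [m [HK Ha]]] [L [p [HL Hb]]]. exists (K * L), (m + p)%nat.
split; [apply Rmult_le_pos; assumption|]. intros k.
rewrite Cmod_mult, pow_add.
replace (K * L * (INR (S k) ^ m * INR (S k) ^ p))
  with ((K * INR (S k) ^ m) * (L * INR (S k) ^ p)) by ring.
apply Rmult_le_compat; auto using Cmod_ge_0.
Qed.

Lemma poly_bounded_plus (a b : nat -> C) :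
  poly_bounded a -> poly_bounded b -> poly_bounded (fun k => (a k + b k)%C).
Proof.
intros [K [m [HK Ha]]] [L [p [HL Hb]]]. exists (K + L), (m + p)%nat.
split; [lra|]. intros k.
eapply Rle_trans; [apply Cmod_triangle|].
assert (H1 := one_le_INR_S k).
assert (M1 : INR (S k) ^ m <= INR (S k) ^ (m + p)) by (apply Rle_pow; [exact H1|lia]).
assert (M2 : INR (S k) ^ p <= INR (S k) ^ (m + p)) by (apply Rle_pow; [exact H1|lia]).
specialize (Ha k). specialize (Hb k). nra.
Qed.

Lemma poly_bounded_bounded (a : nat -> C) (K : R) :
  (forall k, Cmod (a k) <= K) -> poly_bounded a.
Proof.
intros H. exists K, O. split.
- eapply Rle_trans; [apply Cmod_ge_0|apply (H O)].
- intros k. simpl. rewrite Rmult_1_r. apply H.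
Qed.

Lemma poly_bounded_const (c : C) : poly_bounded (fun _ => c).
Proof. apply (poly_bounded_bounded _ (Cmod c)). intros; lra. Qed.

Lemma poly_bounded_INR : poly_bounded (fun k => RtoC (INR k)).
Proof.
exists 1, 1%nat. split; [lra|]. intros k.
rewrite Cmod_R, Rabs_pos_eq by apply pos_INR.
rewrite S_INR. simpl. lra.
Qed.

Lemma poly_bounded_shift (a : nat -> C) :
  poly_bounded a -> poly_bounded (fun k => a (S k)).
Proof.
(* The factor [2 ^ m] absorbs the shift, because [k + 2 <= 2 (k + 1)]. *)
intros [K [m [HK Ha]]]. exists (K * 2 ^ m), m.
split; [apply Rmult_le_pos; [exact HK|apply pow_le; lra]|]. intros k.
eapply Rle_trans; [apply Ha|]. rewrite Rmult_assoc, <- Rpow_mult_distr.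
apply Rmult_le_compat_l; [exact HK|]. apply pow_incr.
split; [apply pos_INR|]. assert (H1 := one_le_INR_S k). rewrite (S_INR (S k)). lra.
Qed.

Lemma poly_bounded_unshift (a : nat -> C) :
  poly_bounded (fun k => a (S k)) -> poly_bounded a.
Proof.
intros [K [m [HK Ha]]]. exists (Cmod (a O) + K), m.
assert (H0 := Cmod_ge_0 (a O)).
split; [lra|]. intros k.
assert (P1 : 1 <= INR (S k) ^ m) by (apply pow_R1_Rle, one_le_INR_S).
destruct k as [|k]; [nra|].
eapply Rle_trans; [apply Ha|].
assert (P2 : INR (S k) ^ m <= INR (S (S k)) ^ m).
{ apply pow_incr. split; [apply pos_INR|]. apply le_INR. lia. }
nra.
Qed.

Lemma poly_bounded_summable (a : nat -> C) (r : R) :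
  poly_bounded a -> 0 <= r < 1 -> ex_series (fun k => Cmod (a k) * r ^ k).
Proof.
intros [K [m [HK Ha]]] Hr.
apply (ex_series_le (K := R_AbsRing) (V := R_CompleteNormedModule) _
    (fun k => K * (INR (S k) ^ m * r ^ k))).
2:{ apply (ex_series_scal_l (V := R_NormedModule)). apply ex_series_poly_geom, Hr. }
intros k. change (Rabs (Cmod (a k) * r ^ k) <= K * (INR (S k) ^ m * r ^ k)).
assert (0 <= r ^ k) by (apply pow_le; lra).
rewrite Rabs_pos_eq by (apply Rmult_le_pos; [apply Cmod_ge_0|assumption]).
rewrite <- Rmult_assoc. apply Rmult_le_compat_r; auto.
Qed.

(** * Power series on the disk and termwise differentiation *)

Definition C_PSeries (a : nat -> C) (z : C) : C := C_Series (fun k => (a k * z ^ k)%C).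

Lemma C_PSeries_summable (a : nat -> C) (z : C) :
  poly_bounded a -> unit_disk z -> abs_summable (fun k => (a k * z ^ k)%C).
Proof.
intros Ha Hz. apply (abs_summable_le _ (fun k => Cmod (a k) * Cmod z ^ k)).
- intros k. rewrite Cmod_mult, Cmod_pow. lra.
- apply poly_bounded_summable; [exact Ha|]. split; [apply Cmod_ge_0|exact Hz].
Qed.

Lemma C_PSeries_0 (a : nat -> C) : poly_bounded a -> C_PSeries a 0 = a O.
Proof.
intros Ha. unfold C_PSeries. rewrite C_Series_incr_1.
(* The tail is written as [0 * 0] so that pulling out the scalar evaluates its sum to 0. *)
- rewrite (C_Series_ext _ (fun _ => (0 * 0)%C)) by (intros k; simpl; ring).
  assert (E : C_Series (fun _ => (0 * 0)%C) = RtoC 0).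
  { unfold C_Series. simpl. apply injective_projections; simpl;
      rewrite (Series_ext _ (fun _ => 0 * 0)) by (intros; simpl; ring);
      rewrite (Series_scal_l 0 (fun _ => 0)); ring. }
  rewrite E. simpl. ring.
- apply C_PSeries_summable; [exact Ha|]. unfold unit_disk. rewrite Cmod_0. lra.
Qed.

Lemma C_PSeries_incr (a : nat -> C) (z : C) :
  poly_bounded a -> unit_disk z ->
  C_PSeries a z = (a O + z * C_PSeries (fun k => a (S k)) z)%C.
Proof.
intros Ha Hz. unfold C_PSeries at 1.
rewrite C_Series_incr_1 by (apply C_PSeries_summable; assumption).
unfold C_PSeries. rewrite <- C_Series_scal.
- simpl Cpow at 1. rewrite Cmult_1_r. f_equal. apply C_Series_ext. intros k. simpl. ring.
- apply (C_PSeries_summable (fun k => a (S k))); [apply poly_bounded_shift, Ha|exact Hz].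
Qed.

Lemma C_PSeries_plus (a b : nat -> C) (z : C) :
  poly_bounded a -> poly_bounded b -> unit_disk z ->
  C_PSeries (fun k => (a k + b k)%C) z = (C_PSeries a z + C_PSeries b z)%C.
Proof.
intros Ha Hb Hz. unfold C_PSeries.
rewrite <- C_Series_plus by (apply C_PSeries_summable; assumption).
apply C_Series_ext. intros k. ring.
Qed.

Lemma C_PSeries_scal (c : C) (a : nat -> C) (z : C) :
  poly_bounded a -> unit_disk z ->
  C_PSeries (fun k => (c * a k)%C) z = (c * C_PSeries a z)%C.
Proof.
intros Ha Hz. unfold C_PSeries.
rewrite <- C_Series_scal by (apply C_PSeries_summable; assumption).
apply C_Series_ext. intros k. ring.
Qed.

Definition C_PS_derive (a : nat -> C) (k : nat) : C := (RtoC (INR (S k)) * a (S k))%C.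

Lemma poly_bounded_derive (a : nat -> C) :
  poly_bounded a -> poly_bounded (C_PS_derive a).
Proof.
intros Ha. apply (poly_bounded_shift (fun k => (RtoC (INR k) * a k)%C)).
apply poly_bounded_mult; [apply poly_bounded_INR|exact Ha].
Qed.

(* [k z^(k-1)] is the derivative of [z^k]; the truncated predecessor is
   harmless because the factor [k] kills the term at [k = 0]. *)
Definition pow_rem (z w : C) (k : nat) : C :=
  (w ^ k - z ^ k - (w - z) * (RtoC (INR k) * z ^ pred k))%C.

(** This is the bound [k r^(k-1) |w - z|], multiplied by [r] to avoid a predecessor and a division;
    the factor [r * r] in the next lemma has the same purpose. *)
Lemma Cmod_pow_diff (z w : C) (r : R) (k : nat) :
  Cmod z <= r -> Cmod w <= r ->
  r * Cmod (w ^ k - z ^ k) <= INR k * r ^ k * Cmod (w - z).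
Proof.
intros Hz Hw. assert (Hr : 0 <= r) by (eapply Rle_trans; [apply Cmod_ge_0|exact Hz]).
assert (D := Cmod_ge_0 (w - z)).
induction k as [|k IH].
- simpl. replace (1 - 1)%C with (RtoC 0) by ring. rewrite Cmod_0. lra.
- replace (w ^ S k - z ^ S k)%C with (w * (w ^ k - z ^ k) + z ^ k * (w - z))%C
    by (simpl; ring).
  assert (P : Cmod z ^ k <= r ^ k) by (apply pow_incr; split; [apply Cmod_ge_0|exact Hz]).
  assert (P0 : 0 <= r ^ k) by (apply pow_le; exact Hr).
  assert (T := Cmod_triangle (w * (w ^ k - z ^ k)) (z ^ k * (w - z))).
  rewrite !Cmod_mult, Cmod_pow in T.
  assert (Q1 : Cmod w * Cmod (w ^ k - z ^ k) <= r * Cmod (w ^ k - z ^ k))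
    by (apply Rmult_le_compat_r; [apply Cmod_ge_0|exact Hw]).
  assert (Q2 : Cmod z ^ k * Cmod (w - z) <= r ^ k * Cmod (w - z))
    by (apply Rmult_le_compat_r; assumption).
  rewrite S_INR. simpl pow.
  replace ((INR k + 1) * (r * r ^ k) * Cmod (w - z))
    with (r * (INR k * r ^ k * Cmod (w - z) + r ^ k * Cmod (w - z))) by ring.
  apply Rmult_le_compat_l; [exact Hr|]. lra.
Qed.

(** The remainders satisfy [rem_(k+1) = z rem_k + (w - z) (w^k - z^k)], and the induction closes
    because [k^2 + k <= (k + 1)^2]. *)
Lemma Cmod_pow_rem (z w : C) (r : R) (k : nat) :
  Cmod z <= r -> Cmod w <= r ->
  r * r * Cmod (pow_rem z w k) <= INR k ^ 2 * r ^ k * (Cmod (w - z) * Cmod (w - z)).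
Proof.
intros Hz Hw. assert (Hr : 0 <= r) by (eapply Rle_trans; [apply Cmod_ge_0|exact Hz]).
assert (D := Cmod_ge_0 (w - z)).
induction k as [|k IH].
- unfold pow_rem. simpl. replace (1 - 1 - (w - z) * (0 * 1))%C with (RtoC 0) by ring.
  rewrite Cmod_0. lra.
- assert (E : pow_rem z w (S k) = (z * pow_rem z w k + (w - z) * (w ^ k - z ^ k))%C).
  { unfold pow_rem. rewrite S_INR, RtoC_plus. destruct k as [|k]; [simpl; ring|].
    simpl pred. simpl Cpow. ring. }
  rewrite E.
  assert (T := Cmod_triangle (z * pow_rem z w k) ((w - z) * (w ^ k - z ^ k))).
  rewrite !Cmod_mult in T.
  assert (Q1 : Cmod z * Cmod (pow_rem z w k) <= r * Cmod (pow_rem z w k))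
    by (apply Rmult_le_compat_r; [apply Cmod_ge_0|exact Hz]).
  assert (Q2 := Cmod_pow_diff z w r k Hz Hw).
  assert (N := pos_INR k).
  assert (P0 : 0 <= r ^ k) by (apply pow_le; exact Hr).
  set (X := Cmod (pow_rem z w k)) in *. set (Y := Cmod (w ^ k - z ^ k)) in *.
  set (d := Cmod (w - z)) in *.
  assert (X0 : 0 <= X) by apply Cmod_ge_0.
  apply Rle_trans with (r * (r * r * X) + r * (d * (r * Y))).
  { replace (r * (r * r * X) + r * (d * (r * Y))) with (r * r * (r * X + d * Y)) by ring.
    apply Rmult_le_compat_l; [nra|lra]. }
  apply Rle_trans with (r * (INR k ^ 2 * r ^ k * (d * d)) + r * (d * (INR k * r ^ k * d))).
  { apply Rplus_le_compat; apply Rmult_le_compat_l; try exact Hr; [exact IH|].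
    apply Rmult_le_compat_l; assumption. }
  rewrite S_INR. simpl pow.
  replace (r * (INR k * (INR k * 1) * r ^ k * (d * d)) + r * (d * (INR k * r ^ k * d)))
    with ((INR k * INR k + INR k) * (r * r ^ k * (d * d))) by ring.
  replace ((INR k + 1) * ((INR k + 1) * 1) * (r * r ^ k) * (d * d))
    with ((INR k + 1) * (INR k + 1) * (r * r ^ k * (d * d))) by ring.
  apply Rmult_le_compat_r; [|nra].
  apply Rmult_le_pos; [apply Rmult_le_pos; assumption|nra].
Qed.

Lemma C_PSeries_derive_eq (a : nat -> C) (z : C) :
  poly_bounded a -> unit_disk z ->
  C_PSeries (C_PS_derive a) z = C_Series (fun k => (a k * (RtoC (INR k) * z ^ pred k))%C).
Proof.
intros Ha Hz.
rewrite (C_Series_incr_n _ 1).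
- unfold C_PSeries, C_PS_derive. apply C_Series_ext. intros k. change (1 + k)%nat with (S k). change (pred (S k)) with k. ring.
- intros k Hk. replace k with O by lia. simpl. ring.
Qed.

(** The error of the linear approximation is the sum of [a k * pow_rem z w k]. It is at most a
    constant times [|w - z|^2], the constant being controlled by the convergent sum of
    [k^2 |a k| r^k]. *)
Lemma is_C_derive_PSeries (a : nat -> C) (z : C) :
  poly_bounded a -> unit_disk z ->
  is_C_derive (C_PSeries a) z (C_PSeries (C_PS_derive a) z).
Proof.
intros Ha Hz. apply is_C_derive_eps. intros eps He.
(* A radius strictly between [|z|] and 1, valid for all [w] near [z]. *)
set (r := (1 + Cmod z) / 2).
assert (Z0 := Cmod_ge_0 z). unfold unit_disk in Hz.
assert (Hr : Cmod z < r < 1) by (unfold r; lra).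
set (b := fun k => Cmod (RtoC (INR k) * (RtoC (INR k) * a k)) * r ^ k).
assert (Hb : ex_series b).
{ apply (poly_bounded_summable (fun k => RtoC (INR k) * (RtoC (INR k) * a k))%C); [|lra].
  apply poly_bounded_mult; [apply poly_bounded_INR|].
  apply poly_bounded_mult; [apply poly_bounded_INR|exact Ha]. }
assert (Hb0 : 0 <= Series b).
{ rewrite <- (Rmult_0_l (Series b)), <- Series_scal_l. apply Series_le; [|exact Hb].
  intros k. assert (0 <= b k) by (apply Rmult_le_pos; [apply Cmod_ge_0|apply pow_le; lra]). lra. }
(* [K - 1] is the constant of the quadratic estimate; adding 1 makes [K] positive even when
   [Series b] vanishes. *)
set (K := 2 * (/ (r * r) * Series b) + 1).
assert (Hrr : 0 < / (r * r)) by (apply Rinv_0_lt_compat; nra).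
assert (HK : 0 < K) by (unfold K; nra).
exists (Rmin (r - Cmod z) (eps / K)). split.
{ apply Rmin_pos; [lra|]. apply Rdiv_lt_0_compat; assumption. }
intros w Hw.
assert (W1 : Cmod (w - z) < r - Cmod z) by (eapply Rlt_le_trans; [exact Hw|apply Rmin_l]).
assert (W2 : Cmod (w - z) < eps / K) by (eapply Rlt_le_trans; [exact Hw|apply Rmin_r]).
assert (W3 : Cmod w <= r) by (assert (T := Cmod_le_sub z w); lra).
assert (D0 := Cmod_ge_0 (w - z)).
assert (S1 : abs_summable (fun k => (a k * w ^ k)%C))
  by (apply C_PSeries_summable; [exact Ha|unfold unit_disk; lra]).
assert (S2 : abs_summable (fun k => (a k * z ^ k)%C))
  by (apply C_PSeries_summable; [exact Ha|exact Hz]).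
assert (B : forall k, Cmod (a k * pow_rem z w k)
  <= / (r * r) * (Cmod (w - z) * Cmod (w - z)) * b k).
{ intros k. unfold b. rewrite !Cmod_mult, Cmod_R, Rabs_pos_eq by apply pos_INR.
  assert (Q := Cmod_pow_rem z w r k (Rlt_le _ _ (proj1 Hr)) W3).
  replace (/ (r * r) * (Cmod (w - z) * Cmod (w - z)) * (INR k * (INR k * Cmod (a k)) * r ^ k))
    with (Cmod (a k) * (/ (r * r) * (INR k ^ 2 * r ^ k * (Cmod (w - z) * Cmod (w - z))))) by ring.
  apply Rmult_le_compat_l; [apply Cmod_ge_0|].
  apply Rmult_le_reg_l with (r * r); [nra|].
  rewrite <- Rmult_assoc, Rinv_r, Rmult_1_l by nra. exact Q. }
assert (S3 : abs_summable (fun k => (a k * (RtoC (INR k) * z ^ pred k))%C)).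
{ unfold abs_summable. apply ex_series_incr_1.
  apply (ex_series_ext (V := R_NormedModule) (fun k => Cmod (C_PS_derive a k * z ^ k))).
  - intros k. unfold C_PS_derive. f_equal. simpl pred. ring.
  - apply C_PSeries_summable; [apply poly_bounded_derive, Ha|exact Hz]. }
rewrite C_PSeries_derive_eq by assumption.
assert (E : (C_PSeries a w - C_PSeries a z
    - (w - z) * C_Series (fun k => a k * (RtoC (INR k) * z ^ pred k)))%C
  = C_Series (fun k => (a k * pow_rem z w k)%C)).
{ unfold C_PSeries.
  transitivity (C_Series (fun k => (a k * w ^ k + (- RtoC 1 * (a k * z ^ k)
    + (- (w - z)) * (a k * (RtoC (INR k) * z ^ pred k))))%C)).
  2:{ apply C_Series_ext. intros k. unfold pow_rem. ring. }
  assert (SC : forall c u, abs_summable u -> abs_summable (fun k => (c * u k)%C)).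
  { intros c u Hu. apply (abs_summable_le _ (fun k => Cmod c * Cmod (u k))).
    - intros k. rewrite Cmod_mult. lra.
    - apply (ex_series_scal_l (V := R_NormedModule)), Hu. }
  rewrite C_Series_plus, C_Series_plus, !C_Series_scal; auto; [ring|].
  apply (abs_summable_le _ (fun k => Cmod (- RtoC 1 * (a k * z ^ k))
    + Cmod (- (w - z) * (a k * (RtoC (INR k) * z ^ pred k))))).
  - intros k. apply Cmod_triangle.
  - apply (ex_series_plus (V := R_NormedModule)).
    + apply (SC _ _ S2).
    + apply (SC _ _ S3). }
rewrite E.
assert (Hb' : ex_series (fun k => / (r * r) * (Cmod (w - z) * Cmod (w - z)) * b k))
  by (apply (ex_series_scal_l (V := R_NormedModule)), Hb).
assert (M := Cmod_C_Series _ _ B Hb').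
rewrite Series_scal_l in M. eapply Rle_trans; [exact M|].
replace (2 * (/ (r * r) * (Cmod (w - z) * Cmod (w - z)) * Series b))
  with ((K - 1) * Cmod (w - z) * Cmod (w - z)) by (unfold K; ring).
apply Rmult_le_compat_r; [exact D0|].
assert (K * Cmod (w - z) <= eps).
{ apply Rlt_le. apply Rmult_lt_reg_l with (/ K); [apply Rinv_0_lt_compat, HK|].
  rewrite <- Rmult_assoc, Rinv_l, Rmult_1_l by lra. rewrite Rmult_comm. exact W2. }
lra.
Qed.

Fixpoint C_PS_derive_n (a : nat -> C) (n : nat) : nat -> C :=
  match n with O => a | S m => C_PS_derive (C_PS_derive_n a m) end.

(** [hadamard] reads coefficients from iterated derivatives at 0; this lemma lets them be read from
    any expansion of polynomial growth. *)
Lemma taylor_coeff_PSeries (f : C -> C) (a : nat -> C) (k : nat) :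
  poly_bounded a -> (forall z, unit_disk z -> f z = C_PSeries a z) ->
  taylor_coeff f k = a k.
Proof.
intros Ha Hf.
assert (PB : forall n, poly_bounded (C_PS_derive_n a n)).
{ induction n as [|n IH]; [exact Ha|apply poly_bounded_derive, IH]. }
assert (D : forall n z, unit_disk z -> C_derive_n f n z = C_PSeries (C_PS_derive_n a n) z).
{ induction n as [|n IH]; intros z Hz; [apply Hf, Hz|]. simpl.
  apply Complex.is_C_derive_unique.
  apply (is_C_derive_ext_disk (C_PSeries (C_PS_derive_n a n))); [exact Hz| |].
  - intros w Hw. symmetry. apply IH, Hw.
  - apply is_C_derive_PSeries; [apply PB|exact Hz]. }
(* Only [j = 0] is needed in the end, but each differentiation raises the index [j], so the
   induction on [n] needs every [j]. *)
assert (V : forall n j, (RtoC (INR (fact j)) * C_PS_derive_n a n j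
  = RtoC (INR (fact (j + n))) * a (j + n)%nat)%C).
{ induction n as [|n IH]; intros j.
  - rewrite Nat.add_0_r. reflexivity.
  - simpl C_PS_derive_n. unfold C_PS_derive. rewrite Cmult_assoc, <- RtoC_mult, <- mult_INR.
    replace (fact j * S j)%nat with (fact (S j)) by (simpl; lia).
    rewrite IH. replace (S j + n)%nat with (j + S n)%nat by lia. reflexivity. }
assert (U0 : unit_disk 0) by (unfold unit_disk; rewrite Cmod_0; lra).
unfold taylor_coeff. rewrite D, C_PSeries_0 by (try exact U0; apply PB).
assert (V0 := V k O). change (INR (fact 0)) with 1 in V0. rewrite Cmult_1_l in V0.
rewrite V0. change (0 + k)%nat with k. field.
intros F. apply (INR_fact_neq_0 k). apply (f_equal Re) in F. exact F.
Qed.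

(** * Expansions of rational functions with poles on the unit circle *)

(* Coefficients of [A(z) / (1 - q z)]. *)
Fixpoint geom_conv (q : C) (a : nat -> C) (k : nat) : C :=
  match k with O => a O | S j => (q * geom_conv q a j + a (S j))%C end.

(** Since [|q| = 1], coefficient [k] is a sum of [k + 1] terms of modulus at most [K (k + 1)^m], so
    the exponent grows by one. *)
Lemma poly_bounded_geom_conv (q : C) (a : nat -> C) :
  Cmod q = 1 -> poly_bounded a -> poly_bounded (geom_conv q a).
Proof.
intros Hq [K [m [HK Ha]]]. exists K, (S m). split; [exact HK|].
assert (H : forall k, Cmod (geom_conv q a k) <= K * INR (S k) ^ m * INR (S k)).
2:{ intros k. eapply Rle_trans; [apply H|]. right. rewrite <- tech_pow_Rmult. ring. }
induction k as [|k IH].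
- change (INR 1) with 1. rewrite Rmult_1_r. apply (Ha O).
- simpl geom_conv. eapply Rle_trans; [apply Cmod_triangle|].
  rewrite Cmod_mult, Hq, Rmult_1_l.
  assert (P : INR (S k) ^ m <= INR (S (S k)) ^ m).
  { apply pow_incr. split; [apply pos_INR|]. apply le_INR. lia. }
  assert (P0 := pos_INR (S k)). specialize (Ha (S k)).
  rewrite (S_INR (S k)) at 2.
  assert (K * INR (S k) ^ m * INR (S k) <= K * INR (S (S k)) ^ m * INR (S k)).
  { apply Rmult_le_compat_r; [exact P0|]. apply Rmult_le_compat_l; assumption. }
  lra.
Qed.

Lemma C_PSeries_geom_conv (q : C) (a : nat -> C) (z : C) :
  Cmod q = 1 -> poly_bounded a -> unit_disk z ->
  ((1 - q * z) * C_PSeries (geom_conv q a) z)%C = C_PSeries a z.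
Proof.
intros Hq Ha Hz. assert (Hg := poly_bounded_geom_conv q a Hq Ha).
rewrite (C_PSeries_incr a z) by assumption.
assert (E : C_PSeries (geom_conv q a) z
  = (a O + z * (q * C_PSeries (geom_conv q a) z + C_PSeries (fun k => a (S k)) z))%C).
{ rewrite <- C_PSeries_scal by assumption.
  rewrite <- (C_PSeries_plus (fun k => (q * geom_conv q a k)%C)).
  - exact (C_PSeries_incr (geom_conv q a) z Hg Hz).
  - apply (poly_bounded_mult (fun _ => q)); [apply poly_bounded_const|exact Hg].
  - apply poly_bounded_shift, Ha.
  - exact Hz. }
transitivity (C_PSeries (geom_conv q a) z - q * z * C_PSeries (geom_conv q a) z)%C; [ring|].
rewrite E at 1. ring.
Qed.

Definition delta0 (k : nat) : C := match k with O => RtoC 1 | _ => RtoC 0 end.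

Lemma poly_bounded_delta0 : poly_bounded delta0.
Proof.
apply (poly_bounded_bounded _ 1).
intros [|k]; simpl; [rewrite Cmod_1|rewrite Cmod_0]; lra.
Qed.

Lemma C_PSeries_delta0 (z : C) : unit_disk z -> C_PSeries delta0 z = RtoC 1.
Proof.
intros Hz. assert (Ho := poly_bounded_delta0).
rewrite C_PSeries_incr by assumption.
unfold C_PSeries.
rewrite (C_Series_ext _ (fun k => (0 * (delta0 k * z ^ k))%C)) by (intros k; simpl; ring).
rewrite C_Series_scal by (apply C_PSeries_summable; assumption). simpl. ring.
Qed.

(* Coefficients of [1 / (1 - q z^n)]. *)
Definition geom_lacunary (n : nat) (q : C) (k : nat) : C :=
  if Nat.eqb (k mod n) 0 then (q ^ (k / n))%C else RtoC 0.

Lemma poly_bounded_geom_lacunary (n : nat) (q : C) :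
  Cmod q = 1 -> poly_bounded (geom_lacunary n q).
Proof.
intros Hq. apply (poly_bounded_bounded _ 1). intros k. unfold geom_lacunary.
destruct (Nat.eqb _ _).
- rewrite Cmod_pow, Hq, pow1. lra.
- rewrite Cmod_0. lra.
Qed.

(** After the constant term is removed, the coefficients below index [n] vanish, and shifting by [n]
    reproduces the series multiplied by [q z^n]. *)
Lemma C_PSeries_geom_lacunary (n : nat) (q z : C) :
  (1 <= n)%nat -> Cmod q = 1 -> unit_disk z ->
  ((1 - q * z ^ n) * C_PSeries (geom_lacunary n q) z)%C = RtoC 1.
Proof.
intros Hn Hq Hz. assert (Hg := poly_bounded_geom_lacunary n q Hq).
assert (Ho := poly_bounded_delta0).
assert (Em := poly_bounded_mult _ _ (poly_bounded_const (- RtoC 1)) Ho). simpl in Em.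
assert (O1 := C_PSeries_delta0 z Hz).
assert (E : C_PSeries (fun k => (geom_lacunary n q k + - RtoC 1 * delta0 k)%C) z
  = (q * z ^ n * C_PSeries (geom_lacunary n q) z)%C).
{ unfold C_PSeries. rewrite (C_Series_incr_n _ n).
  - rewrite <- C_Series_scal by (apply C_PSeries_summable; assumption).
    apply C_Series_ext. intros k. rewrite Cpow_add_r.
    unfold geom_lacunary.
    replace ((n + k) mod n) with (k mod n)
      by (replace (n + k)%nat with (k + 1 * n)%nat by lia; rewrite Nat.Div0.mod_add; reflexivity).
    replace ((n + k) / n)%nat with (S (k / n))
      by (replace (n + k)%nat with (k + 1 * n)%nat by lia; rewrite Nat.div_add by lia; lia).
    replace (delta0 (n + k)%nat) with (RtoC 0) by (destruct n; [lia|reflexivity]).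
    destruct (Nat.eqb _ _); simpl; ring.
  - intros [|k] Hk; unfold geom_lacunary; simpl delta0.
    + rewrite Nat.Div0.mod_0_l, Nat.Div0.div_0_l. simpl. ring.
    + rewrite Nat.mod_small by exact Hk. simpl. ring. }
rewrite C_PSeries_plus in E by assumption.
rewrite C_PSeries_scal in E by assumption. rewrite O1 in E.
transitivity (C_PSeries (geom_lacunary n q) z - q * z ^ n * C_PSeries (geom_lacunary n q) z)%C; [ring|].
rewrite <- E. ring.
Qed.

(** * Recovering a function from the power series of its derivative *)

(** Along the radius [s |-> s z] the real and imaginary parts of [f] have derivative 0 by the chain
    rule, hence are constant. *)
Lemma is_C_derive_zero_disk (f : C -> C) (z : C) :
  (forall w, unit_disk w -> is_C_derive f w (RtoC 0)) -> unit_disk z -> f z = f (RtoC 0).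
Proof.
intros H Hz.
assert (D : forall t, 0 <= t <= 1 ->
  derivable_pt_lim (fun s => Re (f (s * fst z, s * snd z))) t 0 /\
  derivable_pt_lim (fun s => Im (f (s * fst z, s * snd z))) t 0).
{ intros t Ht.
  assert (Hw : unit_disk (t * fst z, t * snd z)).
  { unfold unit_disk in *. replace (t * fst z, t * snd z) with (RtoC t * z)%C
      by (apply injective_projections; simpl; ring).
    rewrite Cmod_mult, Cmod_R, Rabs_pos_eq by lra.
    assert (H0 := Cmod_ge_0 z). nra. }
  assert (L : forall c, derivable_pt_lim (fun s => s * c) t c).
  { intros c. apply is_derive_Reals. auto_derive; [exact I|ring]. }
  assert (H1 := is_C_derive_re _ _ _ _ (H _ Hw)).
  assert (H2 := is_C_derive_im _ _ _ _ (H _ Hw)).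
  split.
  - replace 0 with (Re 0 * fst z + - Im 0 * snd z) by (simpl; ring).
    apply (derivable_pt_lim_comp_2d (fun u v => Re (f (u, v))) (fun s => s * fst z) (fun s => s * snd z)); auto.
  - replace 0 with (Im 0 * fst z + Re 0 * snd z) by (simpl; ring).
    apply (derivable_pt_lim_comp_2d (fun u v => Im (f (u, v))) (fun s => s * fst z) (fun s => s * snd z)); auto. }
assert (E1 : (1 * fst z, 1 * snd z) = z) by (apply injective_projections; simpl; ring).
assert (E0 : (0 * fst z, 0 * snd z) = RtoC 0) by (apply injective_projections; simpl; ring).
rewrite <- E1, <- E0.
apply injective_projections; symmetry.
- apply (eq_is_derive (V := R_NormedModule) (fun s => Re (f (s * fst z, s * snd z))) 0 1); [|lra].
  intros t Ht. apply is_derive_Reals. apply D, Ht.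
- apply (eq_is_derive (V := R_NormedModule) (fun s => Im (f (s * fst z, s * snd z))) 0 1); [|lra].
  intros t Ht. apply is_derive_Reals. apply D, Ht.
Qed.

Definition C_PS_primitive (a : nat -> C) (k : nat) : C :=
  match k with O => RtoC 0 | S j => (a j / RtoC (INR (S j)))%C end.

Lemma poly_bounded_primitive (a : nat -> C) :
  poly_bounded a -> poly_bounded (C_PS_primitive a).
Proof.
intros Ha. apply poly_bounded_unshift.
apply (poly_bounded_mult a (fun k => (/ RtoC (INR (S k)))%C)); [exact Ha|].
apply (poly_bounded_bounded _ 1). intros k. assert (H := one_le_INR_S k).
rewrite <- RtoC_inv, Cmod_R, Rabs_pos_eq
  by first [lra | apply Rlt_le, Rinv_0_lt_compat; lra].
rewrite <- Rinv_1. apply Rinv_le_contravar; lra.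
Qed.

Lemma C_PSeries_of_derive (f : C -> C) (d : nat -> C) :
  poly_bounded d -> f (RtoC 0) = RtoC 0 ->
  (forall z, unit_disk z -> is_C_derive f z (C_PSeries d z)) ->
  forall z, unit_disk z -> f z = C_PSeries (C_PS_primitive d) z.
Proof.
intros Hd H0 Hf z Hz. assert (Hp := poly_bounded_primitive d Hd).
assert (E := is_C_derive_zero_disk (fun w => f w - C_PSeries (C_PS_primitive d) w)%C z).
simpl in E. rewrite H0, C_PSeries_0 in E by exact Hp. simpl in E.
assert (X : (f z - C_PSeries (C_PS_primitive d) z = 0 - 0)%C).
{ apply E; [|exact Hz]. intros w Hw.
  replace (RtoC 0) with (C_PSeries d w - C_PSeries d w)%C by ring.
  apply is_C_derive_minus; [apply Hf, Hw|].
  assert (Q := is_C_derive_PSeries _ w Hp Hw).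
  replace (C_PSeries d w) with (C_PSeries (C_PS_derive (C_PS_primitive d)) w); [exact Q|].
  apply C_Series_ext. intros k. unfold C_PS_derive, C_PS_primitive. f_equal. field.
  intros F. apply (f_equal Re) in F. assert (H := one_le_INR_S k). simpl in F, H. lra. }
replace (f z) with ((f z - C_PSeries (C_PS_primitive d) z) + C_PSeries (C_PS_primitive d) z)%C by ring.
rewrite X. ring.
Qed.

(** * Harmonic maps of a half-plane that are shears in the real direction *)

Lemma derivable_pt_lim_section_y (f : R -> R -> R) (x y lx ly : R) :
  differentiable_pt_lim f x y lx ly -> derivable_pt_lim (fun v => f x v) y ly.
Proof.
intros H. replace ly with (lx * 0 + ly * 1) by ring.
apply (derivable_pt_lim_comp_2d f (fun _ => x) (fun v => v)); [exact H| |].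
- apply derivable_pt_lim_const.
- apply derivable_pt_lim_id.
Qed.

(* Along the curve [x |-> (x, Y x)] the expansion of [I] at [(x, Y x)] has
   vanishing left-hand side, and the growth bound makes [Y] Lipschitz at [x]. *)
Lemma derivable_level_curve (I : R -> R -> R) (Y : R -> R) (b x s lx ly : R) (m : R -> R) :
  b < x -> 0 < ly ->
  differentiable_pt_lim I x (Y x) lx ly ->
  (forall x', b < x' -> I x' (Y x') = s) ->
  0 < m x -> continuity_pt m x ->
  (forall x' y y', b < x' -> m x' * Rabs (y' - y) <= Rabs (I x' y' - I x' y)) ->
  derivable_pt_lim Y x (- lx / ly).
Proof.
intros Hx Hly D HY Hm Cm G.
(* Continuity of [m] makes the growth rate in [y] uniform near [x]. *)
assert (Hmn : exists d, 0 < d /\ forall x', Rabs (x' - x) < d -> m x / 2 < m x').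
{ destruct (Cm (m x / 2) ltac:(lra)) as [d [Hd H]]. exists d. split; [exact Hd|].
  intros x' Hx'. destruct (Req_dec x' x) as [->|N]; [lra|].
  assert (B : Rabs (m x' - m x) < m x / 2).
  { apply H. split; [split; [exact Logic.I|congruence]|exact Hx']. }
  apply Rabs_def2 in B. lra. }
destruct Hmn as [d0 [Hd0 Hm']].
destruct (D (mkposreal 1 Rlt_0_1)) as [d1 H1]. simpl in H1.
(* The expansion with tolerance 1 at fixed height [Y x] gives
   [|I (x + h) (Y x) - s| <= (|lx| + 1) |h|]; dividing by the growth rate [m x / 2] bounds
   [|Y (x + h) - Y x|]. *)
set (La := (Rabs lx + 1) / (m x / 2)).
assert (L0 := Rabs_pos lx).
assert (HLa : 0 < La) by (unfold La; apply Rdiv_lt_0_compat; lra).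
set (d2 := Rmin d0 (Rmin d1 (x - b))).
assert (Hd2 : 0 < d2).
{ unfold d2. repeat apply Rmin_pos; try lra. apply cond_pos. }
assert (Lip : forall h, Rabs h < d2 -> Rabs (Y (x + h) - Y x) <= La * Rabs h /\ b < x + h).
{ intros h Hh.
  assert (A0 : Rabs h < d0) by (eapply Rlt_le_trans; [exact Hh|apply Rmin_l]).
  assert (A1 : Rabs h < d1).
  { eapply Rlt_le_trans; [exact Hh|]. eapply Rle_trans; [apply Rmin_r|apply Rmin_l]. }
  assert (A2 : Rabs h < x - b).
  { eapply Rlt_le_trans; [exact Hh|]. eapply Rle_trans; [apply Rmin_r|apply Rmin_r]. }
  assert (A3 : b < x + h) by (apply Rabs_def2 in A2; lra).
  split; [|exact A3].
  assert (E : x + h - x = h) by ring.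
  assert (M := Hm' (x + h)). rewrite E in M. specialize (M A0).
  assert (B := H1 (x + h) (Y x)). rewrite E in B.
  replace (Y x - Y x) with 0 in B by ring. rewrite Rabs_R0 in B.
  specialize (B A1 (cond_pos d1)).
  rewrite Rmax_left in B by apply Rabs_pos.
  assert (Gx := G (x + h) (Y x) (Y (x + h)) A3).
  rewrite (HY (x + h) A3), <- (HY x Hx) in Gx.
  assert (T : Rabs (I x (Y x) - I (x + h) (Y x)) <= Rabs lx * Rabs h + Rabs h).
  { replace (I x (Y x) - I (x + h) (Y x)) with
      (- (lx * h) + - (I (x + h) (Y x) - I x (Y x) - (lx * h + ly * 0))) by ring.
    eapply Rle_trans; [apply Rabs_triang|]. rewrite !Rabs_Ropp, Rabs_mult. lra. }
  assert (D0 := Rabs_pos (Y (x + h) - Y x)).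
  apply Rmult_le_reg_l with (m x / 2); [lra|].
  replace (m x / 2 * (La * Rabs h)) with (Rabs lx * Rabs h + Rabs h) by (unfold La; field; lra).
  nra. }
intros eps He.
(* Both increments are at most [(1 + La) |h|], so this tolerance leaves [eps / 2] after division by
   [ly |h|]. *)
assert (He' : 0 < eps * ly / (2 * (1 + La))).
{ apply Rdiv_lt_0_compat; [|lra]. apply Rmult_lt_0_compat; lra. }
destruct (D (mkposreal _ He')) as [d3 H3]. simpl in H3.
assert (Hd3 := cond_pos d3).
assert (Hd : 0 < Rmin d2 (d3 / (1 + La))).
{ apply Rmin_pos; [exact Hd2|]. apply Rdiv_lt_0_compat; lra. }
exists (mkposreal _ Hd). simpl. intros h Hh0 Hh.
assert (B2 : Rabs h < d2) by (eapply Rlt_le_trans; [exact Hh|apply Rmin_l]).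
assert (B3 : Rabs h < d3 / (1 + La)) by (eapply Rlt_le_trans; [exact Hh|apply Rmin_r]).
assert (B4 : (1 + La) * Rabs h < d3).
{ apply Rmult_lt_reg_l with (/ (1 + La)); [apply Rinv_0_lt_compat; lra|].
  rewrite <- Rmult_assoc, Rinv_l, Rmult_1_l by lra. rewrite Rmult_comm. exact B3. }
destruct (Lip h B2) as [L Hb].
assert (Hp : 0 < Rabs h) by (apply Rabs_pos_lt, Hh0).
assert (Q := H3 (x + h) (Y (x + h))).
replace (x + h - x) with h in Q by ring.
specialize (Q ltac:(nra) ltac:(nra)).
rewrite (HY (x + h) Hb), <- (HY x Hx) in Q.
assert (Mx : Rmax (Rabs h) (Rabs (Y (x + h) - Y x)) <= (1 + La) * Rabs h)
  by (apply Rmax_lub; nra).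
assert (Q' : Rabs (lx * h + ly * (Y (x + h) - Y x)) <= eps * ly / 2 * Rabs h).
{ replace (lx * h + ly * (Y (x + h) - Y x)) with
    (- (I x (Y x) - I x (Y x) - (lx * h + ly * (Y (x + h) - Y x)))) by ring.
  rewrite Rabs_Ropp. eapply Rle_trans; [exact Q|].
  eapply Rle_trans; [apply Rmult_le_compat_l; [lra|exact Mx]|].
  right. field. lra. }
replace ((Y (x + h) - Y x) / h - - lx / ly)
  with ((lx * h + ly * (Y (x + h) - Y x)) * / (ly * h)) by (field; lra).
rewrite Rabs_mult, Rabs_inv, Rabs_mult, (Rabs_pos_eq ly) by lra.
apply Rle_lt_trans with (eps * ly / 2 * Rabs h * / (ly * Rabs h)).
- apply Rmult_le_compat_r; [|exact Q']. apply Rlt_le, Rinv_0_lt_compat. nra.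
- replace (eps * ly / 2 * Rabs h * / (ly * Rabs h)) with (eps / 2) by (field; lra). lra.
Qed.

(** [E] is a continuous image of [(b, +oo)]. If [U] and [V] separated it, the indicator [chi] of [U]
    along the curve would be locally constant with derivative 0, hence constant, yet it takes the
    values 1 and 0. *)
Lemma connected_curve_in_line (E : C -> Prop) (r : R -> R) (b : R) (p v : C) :
  (forall z, E z <-> exists x, b < x /\ z = (p + RtoC (r x) * v)%C) ->
  (forall x, b < x -> continuity_pt r x) ->
  connected E.
Proof.
intros HE Hr U V HU HV Hcov [z1 [E1 U1]] [z2 [E2 V2]].
apply NNPP. intros Hno.
set (k := fun x => (p + RtoC (r x) * v)%C).
assert (Near : forall (O : C -> Prop) x, open O -> b < x -> O (k x) -> locally x (fun x' => O (k x'))).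
{ intros O x HO Hx Ok. destruct (HO _ Ok) as [e He].
  assert (N0 := Cmod_ge_0 v).
  assert (Hc : continuous r x) by (apply continuity_pt_filterlim, Hr, Hx).
  assert (Hd : 0 < e / (Cmod v + 1)) by (apply Rdiv_lt_0_compat; [apply cond_pos|lra]).
  specialize (Hc _ (locally_ball (r x) (mkposreal _ Hd))).
  revert Hc. unfold filtermap. apply filter_imp. intros x' Hx'.
  change (Rabs (r x' - r x) < e / (Cmod v + 1)) in Hx'.
  apply He. apply C_NormedModule_mixin_compat1.
  change (Cmod (k x' - k x) < e).
  replace (k x' - k x)%C with (RtoC (r x' - r x) * v)%C by (unfold k; rewrite RtoC_minus; ring).
  rewrite Cmod_mult, Cmod_R.
  apply Rle_lt_trans with (Rabs (r x' - r x) * (Cmod v + 1)).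
  - apply Rmult_le_compat_l; [apply Rabs_pos|lra].
  - apply Rmult_lt_reg_r with (/ (Cmod v + 1)); [apply Rinv_0_lt_compat; lra|].
    rewrite Rmult_assoc, Rinv_r, Rmult_1_r by lra. exact Hx'. }
assert (Nb : forall x, b < x -> locally x (fun x' => b < x')) by (intros x Hx; apply (open_gt b x Hx)).
set (chi := fun x => if excluded_middle_informative (U (k x)) then 1 else 0).
assert (D : forall x, b < x -> is_derive chi x 0).
{ intros x Hx.
  apply (is_derive_ext_loc (fun _ => chi x)); [|apply (is_derive_const (V := R_NormedModule))].
  assert (Ex : E (k x)) by (apply HE; exists x; auto).
  destruct (Hcov _ Ex) as [Ux|Vx].
  - generalize (Near U x HU Hx Ux). apply filter_imp. intros x' Ux'. unfold chi.
    destruct (excluded_middle_informative (U (k x))); [|contradiction].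
    destruct (excluded_middle_informative (U (k x'))); [reflexivity|contradiction].
  - generalize (filter_and _ _ (Near V x HV Hx Vx) (Nb x Hx)). apply filter_imp.
    intros x' [Vx' Hx']. unfold chi.
    assert (NU : forall t, b < t -> V (k t) -> ~ U (k t)).
    { intros t Ht Vt Ut. apply Hno. exists (k t). repeat split; auto. apply HE. exists t; auto. }
    destruct (excluded_middle_informative (U (k x))); [exfalso; apply (NU x); auto|].
    destruct (excluded_middle_informative (U (k x'))); [exfalso; apply (NU x'); auto|reflexivity]. }
destruct (proj1 (HE z1) E1) as [x1 [Hx1 K1]]. destruct (proj1 (HE z2) E2) as [x2 [Hx2 K2]].
assert (C1 : chi x1 = 1).
{ unfold chi. destruct (excluded_middle_informative (U (k x1))) as [|N]; [reflexivity|].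
  exfalso. apply N. unfold k. rewrite <- K1. exact U1. }
assert (C2 : chi x2 = 0).
{ unfold chi. destruct (excluded_middle_informative (U (k x2))) as [Y|]; [|reflexivity].
  exfalso. apply Hno. exists z2. repeat split; auto. rewrite K2. exact Y. }
destruct (Rtotal_order x1 x2) as [L|[L|L]].
- assert (Q := eq_is_derive chi x1 x2 (fun t Ht => D t ltac:(lra)) L). lra.
- subst x2. lra.
- assert (Q := eq_is_derive chi x2 x1 (fun t Ht => D t ltac:(lra)) L). lra.
Qed.

Definition half_plane (b : R) (u : C) : Prop := b < Re u.

(* The shear of [H + conj G] along the real axis is [H - G].  The lower bound
   [m (Re u)] for the real part of its derivative is constant on vertical
   lines, so there [Im (H + conj G) = Im (H - G)] increases from [-oo] to
   [+oo]: each of its level sets is a graph over the whole interval [x > b]. *)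
Section Half_plane.
Variables (b : R) (m : R -> R) (H G P Q : C -> C).
Hypothesis (DH : forall u, half_plane b u -> is_C_derive H u (P u)).
Hypothesis (DG : forall u, half_plane b u -> is_C_derive G u (Q u)).
Hypothesis (m_pos : forall x, b < x -> 0 < m x).
Hypothesis (m_cont : forall x, b < x -> continuity_pt m x).
Hypothesis (shear : forall u, half_plane b u -> m (Re u) <= Re (P u - Q u)).
Hypothesis (jac : forall u, half_plane b u -> Cmod (Q u) < Cmod (P u)).

Let I (x y : R) : R := Im (H (x, y) - G (x, y)).
Let J (x y : R) : R := Re (H (x, y) + G (x, y)).

Lemma harmonic_of_parts (x y : R) : harmonic_of H G (x, y) = (J x y, I x y).
Proof. unfold harmonic_of, I, J. apply injective_projections; simpl; ring. Qed.

Lemma diff_I (x y : R) : b < x ->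
  differentiable_pt_lim I x y (Im (P (x, y) - Q (x, y))) (Re (P (x, y) - Q (x, y))).
Proof.
intros Hx. apply (is_C_derive_im (fun u => (H u - G u)%C)).
apply is_C_derive_minus; [apply DH|apply DG]; exact Hx.
Qed.

Lemma diff_J (x y : R) : b < x ->
  differentiable_pt_lim J x y (Re (P (x, y) + Q (x, y))) (- Im (P (x, y) + Q (x, y))).
Proof.
intros Hx. apply (is_C_derive_re (fun u => (H u + G u)%C)).
apply is_C_derive_plus; [apply DH|apply DG]; exact Hx.
Qed.

Lemma I_growth (x y y' : R) : b < x -> y < y' -> m x * (y' - y) <= I x y' - I x y.
Proof.
intros Hx Hy.
destruct (MVT_gen (I x) y y' (fun v => Re (P (x, v) - Q (x, v)))) as [v [_ E]].
- intros v _. apply is_derive_Reals.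
  exact (derivable_pt_lim_section_y I x v _ _ (diff_I x v Hx)).
- intros v _. apply derivable_continuous_pt.
  exists (Re (P (x, v) - Q (x, v))).
  exact (derivable_pt_lim_section_y I x v _ _ (diff_I x v Hx)).
- rewrite E. apply Rmult_le_compat_r; [lra|]. exact (shear (x, v) Hx).
Qed.

Lemma I_growth_abs (x y y' : R) : b < x -> m x * Rabs (y' - y) <= Rabs (I x y' - I x y).
Proof.
intros Hx. assert (M := m_pos x Hx).
destruct (Rtotal_order y y') as [L|[L|L]].
- assert (T := I_growth x y y' Hx L). rewrite !Rabs_pos_eq; nra.
- subst y'. rewrite !Rminus_diag, Rabs_R0. lra.
- assert (T := I_growth x y' y Hx L). rewrite !(Rabs_minus_sym _ y), (Rabs_minus_sym (I x y')).
  rewrite !Rabs_pos_eq; nra.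
Qed.

Lemma I_surjective (x s : R) : b < x -> exists y, I x y = s.
Proof.
intros Hx. assert (M := m_pos x Hx).
(* Over a height [N], the growth of [I x] is at least [|s - I x 0|] on either side of 0, so [s] lies
   between the values at [- N] and [N]. *)
set (N := Rabs (s - I x 0) / m x + 1).
assert (A := Rabs_pos (s - I x 0)).
assert (N1 : 0 < N).
{ unfold N. assert (0 <= Rabs (s - I x 0) / m x) by (apply Rle_div_r; lra). lra. }
assert (N2 : Rabs (s - I x 0) <= m x * N).
{ unfold N. replace (m x * (Rabs (s - I x 0) / m x + 1)) with (Rabs (s - I x 0) + m x) by (field; lra). lra. }
assert (U := I_growth x 0 N Hx N1).
assert (L := I_growth x (- N) 0 Hx ltac:(lra)).
assert (B : - Rabs (s - I x 0) <= s - I x 0 <= Rabs (s - I x 0)) by (apply Rabs_le_between; lra).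
destruct (IVT_gen (I x) (- N) N s) as [y [_ Hy]].
- intros v. apply derivable_continuous_pt. exists (Re (P (x, v) - Q (x, v))).
  exact (derivable_pt_lim_section_y I x v _ _ (diff_I x v Hx)).
- rewrite Rmin_left, Rmax_right by lra. lra.
- exists y. exact Hy.
Qed.

(** The level set [I = s] is the graph of [Y], of slope [- Im (p - q) / Re (p - q)] with [p], [q]
    the values of [P], [Q]. The derivative of [J] along it is then [(|p|^2 - |q|^2) / Re (p - q)],
    which is positive by [jac] and [shear]. *)
Lemma level_curve (s : R) : exists Y r : R -> R,
  (forall x, b < x -> I x (Y x) = s) /\
  (forall x y, b < x -> I x y = s -> y = Y x) /\
  (forall x, b < x -> continuity_pt r x) /\
  (forall x x', b < x -> x < x' -> r x < r x') /\
  (forall x, b < x -> r x = J x (Y x)).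
Proof.
(* The condition [b < x] is placed under the existential so that choice yields a total function,
   with a dummy value outside the half-plane. *)
assert (Ch : forall x, exists y, b < x -> I x y = s).
{ intros x. destruct (Rlt_dec b x) as [Hx|Hx].
  - destruct (I_surjective x s Hx) as [y Hy]. exists y. auto.
  - exists 0. intros; contradiction. }
set (Y := fun x => proj1_sig (constructive_indefinite_description _ (Ch x))).
assert (HY : forall x, b < x -> I x (Y x) = s).
{ intros x. unfold Y. destruct (constructive_indefinite_description _ (Ch x)) as [y Hy]. exact Hy. }
assert (Der : forall x, b < x -> exists l, 0 < l /\ derivable_pt_lim (fun t => J t (Y t)) x l).
{ intros x Hx. set (p := P (x, Y x)). set (q := Q (x, Y x)).
  assert (Hre : 0 < Re (p - q)).
  { eapply Rlt_le_trans; [apply (m_pos x Hx)|]. exact (shear (x, Y x) Hx). }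
  assert (DY := derivable_level_curve I Y b x s (Im (p - q)) (Re (p - q)) m Hx Hre
    (diff_I x (Y x) Hx) HY (m_pos x Hx) (m_cont x Hx) I_growth_abs).
  exists (Re (p + q) * 1 + - Im (p + q) * (- Im (p - q) / Re (p - q))). split.
  - replace (Re (p + q) * 1 + - Im (p + q) * (- Im (p - q) / Re (p - q)))
      with ((Re (p + q) * Re (p - q) + Im (p + q) * Im (p - q)) / Re (p - q)) by (field; lra).
    apply Rdiv_lt_0_compat; [|exact Hre].
    assert (Jx := jac (x, Y x) Hx). fold p q in Jx.
    assert (N := Cmod_ge_0 q).
    assert (S2 : Cmod q ^ 2 < Cmod p ^ 2) by (simpl; nra).
    rewrite !Cmod2_alt in S2. unfold Re, Im in *. simpl in *. nra.
  - apply (derivable_pt_lim_comp_2d J (fun t => t) Y).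
    + exact (diff_J x (Y x) Hx).
    + apply derivable_pt_lim_id.
    + exact DY. }
exists Y, (fun t => J t (Y t)). repeat split.
- exact HY.
- intros x y Hx Hy. assert (T := I_growth_abs x (Y x) y Hx).
  rewrite (HY x Hx), Hy, Rminus_diag, Rabs_R0 in T.
  assert (M := m_pos x Hx). destruct (Req_dec y (Y x)) as [E|N]; [exact E|].
  assert (0 < Rabs (y - Y x)) by (apply Rabs_pos_lt; lra). nra.
- intros x Hx. destruct (Der x Hx) as [l [_ Hl]].
  apply derivable_continuous_pt. exists l. exact Hl.
- intros x x' Hx Hxx'.
  set (dr := fun t => Derive (fun u => J u (Y u)) t).
  apply (incr_function_le (fun t => J t (Y t)) x x' dr); simpl; try lra.
  + intros t H1 _. destruct (Der t ltac:(lra)) as [l [_ Hl]].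
    apply is_derive_Reals in Hl. unfold dr. rewrite (is_derive_unique _ _ _ Hl). exact Hl.
  + intros t H1 _. destruct (Der t ltac:(lra)) as [l [Hl0 Hl]].
    apply is_derive_Reals in Hl. unfold dr. rewrite (is_derive_unique _ _ _ Hl). exact Hl0.
Qed.

(** Equal imaginary parts put [u] and [v] on one level curve, where the real part is strictly
    increasing in the abscissa. *)
Lemma half_plane_injective (u v : C) :
  half_plane b u -> half_plane b v -> harmonic_of H G u = harmonic_of H G v -> u = v.
Proof.
destruct u as [x y], v as [x' y']. unfold half_plane. simpl. intros Hx Hx' E.
rewrite !harmonic_of_parts in E. apply pair_equal_spec in E. destruct E as [EJ EI].
destruct (level_curve (I x' y')) as [Y [r [_ [HY [_ [Hr Er]]]]]].
assert (Ey := HY x y Hx EI). assert (Ey' := HY x' y' Hx' eq_refl).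
assert (R1 := Er x Hx). assert (R2 := Er x' Hx').
rewrite <- Ey in R1. rewrite <- Ey' in R2.
destruct (Rtotal_order x x') as [L|[L|L]].
- assert (T := Hr x x' Hx L). lra.
- subst x'. rewrite Ey, Ey'. reflexivity.
- assert (T := Hr x' x Hx' L). lra.
Qed.

Lemma half_plane_slice (s : R) : exists r : R -> R,
  (forall x, b < x -> continuity_pt r x) /\
  forall t, (exists u, half_plane b u /\ harmonic_of H G u = (t, s)) <->
            exists x, b < x /\ t = r x.
Proof.
destruct (level_curve s) as [Y [r [HI [HY [Hc [_ Er]]]]]].
exists r. split; [exact Hc|]. intros t. split.
- intros [[x y] [Hx E]]. rewrite harmonic_of_parts in E.
  apply pair_equal_spec in E. destruct E as [EJ EI].
  exists x. split; [exact Hx|]. rewrite (Er x Hx), <- (HY x y Hx EI). symmetry. exact EJ.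
- intros [x [Hx E]]. exists (x, Y x). split; [exact Hx|].
  rewrite harmonic_of_parts, HI by exact Hx. rewrite E, Er by exact Hx. reflexivity.
Qed.
End Half_plane.

(** * Convolution with the kernels *)

Lemma Cmod_expi (t : R) : Cmod (expi t) = 1.
Proof.
unfold Cmod, expi. simpl fst. simpl snd. rewrite <- sqrt_1. f_equal.
assert (H := sin2_cos2 t). unfold Rsqr in H. simpl. lra.
Qed.

Lemma expi_plus (s t : R) : expi (s + t) = (expi s * expi t)%C.
Proof. unfold expi, Cmult. simpl. rewrite cos_plus, sin_plus. f_equal; ring. Qed.

Lemma expi_opp_r (t : R) : (expi t * expi (- t) = 1)%C.
Proof.
rewrite <- expi_plus, Rplus_opp_r. unfold expi. rewrite cos_0, sin_0. reflexivity.
Qed.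

Lemma Cconj_expi (t : R) : Cconj (expi t) = expi (- t).
Proof. unfold expi, Cconj. simpl. rewrite cos_neg, sin_neg. reflexivity. Qed.

Lemma Cplus_1_neq_0 (w : C) : unit_disk w -> (1 + w)%C <> RtoC 0.
Proof.
unfold unit_disk. intros Hw E.
assert (E' : w = (- RtoC 1)%C) by (replace w with ((1 + w) - 1)%C by ring; rewrite E; ring).
rewrite E', Cmod_m1 in Hw. lra.
Qed.

(** * The disk, the Cayley transform and the half-plane *)

Lemma unit_disk_opp (w : C) : unit_disk w -> unit_disk (- w).
Proof. unfold unit_disk. rewrite Cmod_opp. auto. Qed.

Lemma unit_disk_0 : unit_disk 0.
Proof. unfold unit_disk. rewrite Cmod_0. lra. Qed.

Lemma unit_disk_rotate (q w : C) : Cmod q = 1 -> unit_disk w -> unit_disk (q * w).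
Proof. unfold unit_disk. intros Hq. rewrite Cmod_mult, Hq, Rmult_1_l. auto. Qed.

Lemma unit_disk_pow (w : C) (n : nat) : unit_disk w -> unit_disk (w ^ S n).
Proof.
unfold unit_disk. intros Hw. rewrite Cmod_pow. assert (H := Cmod_ge_0 w).
assert (Cmod w ^ n <= 1) by (rewrite <- (pow1 n); apply pow_incr; lra).
simpl. assert (0 <= Cmod w ^ n) by (apply pow_le, H). nra.
Qed.

Lemma Cminus_1_neq_0 (w : C) : unit_disk w -> (1 - w)%C <> RtoC 0.
Proof. intros Hw. apply (Cplus_1_neq_0 (- w)), unit_disk_opp, Hw. Qed.

(** The real part equals [(1 - |w|^2) / |1 + w|^2]. *)
Lemma Re_cayley_pos (w : C) : unit_disk w -> 0 < Re ((1 - w) / (1 + w)).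
Proof.
intros Hw. assert (N := Cplus_1_neq_0 w Hw).
assert (S1 : Cmod w ^ 2 < 1) by (unfold unit_disk in Hw; assert (H := Cmod_ge_0 w); simpl; nra).
rewrite Cmod2_alt in S1.
destruct w as [x y]. simpl in S1.
assert (D : 0 < (1 + x) * (1 + x) + (0 + y) * (0 + y)).
{ destruct (Req_dec (1 + x) 0) as [E1|E1]; [destruct (Req_dec y 0) as [E2|E2]|]; [|nra|nra].
  exfalso. apply N. apply injective_projections; simpl; lra. }
unfold Cdiv, Cmult, Cinv, Re. simpl.
replace ((1 + - x) * ((1 + x) / ((1 + x) * ((1 + x) * 1) + (0 + y) * ((0 + y) * 1))) -
  (0 + - y) * (- (0 + y) / ((1 + x) * ((1 + x) * 1) + (0 + y) * ((0 + y) * 1))))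
  with ((1 - (x * x + y * y)) / ((1 + x) * (1 + x) + (0 + y) * (0 + y))) by (field; lra).
apply Rdiv_lt_0_compat; nra.
Qed.

(** [Re u > -1/2] says that [u] is closer to 0 than to -1, that is [|u| < |1 + u|]. *)
Lemma half_plane_to_disk (u : C) : half_plane (- (1 / 2)) u ->
  (1 + u)%C <> RtoC 0 /\ unit_disk (u / (1 + u)).
Proof.
unfold half_plane. intros Hu.
assert (N : (1 + u)%C <> RtoC 0).
{ intros E. apply (f_equal Re) in E. unfold Re in *. simpl in E. lra. }
split; [exact N|]. unfold unit_disk. rewrite Cmod_div by exact N.
apply Rlt_div_l; [apply Cmod_gt_0, N|]. rewrite Rmult_1_l.
assert (H1 := Cmod_ge_0 u). assert (H2 := Cmod_ge_0 (1 + u)).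
assert (Q : Cmod u ^ 2 < Cmod (1 + u) ^ 2).
{ rewrite !Cmod2_alt. unfold Re, Im in *. simpl. nra. }
simpl in Q. nra.
Qed.

Lemma disk_to_half_plane (w : C) : unit_disk w ->
  half_plane (- (1 / 2)) (w / (1 - w)) /\
  (w / (1 - w) / (1 + w / (1 - w)) = w)%C.
Proof.
intros Hw. assert (N := Cminus_1_neq_0 w Hw). split.
(* With [u = w / (1 - w)] one has [1 + 2 u = (1 + w) / (1 - w)], a Cayley transform. *)
- assert (C1 := Re_cayley_pos (- w) (unit_disk_opp w Hw)).
  replace ((1 - - w) / (1 + - w))%C with (1 + (w / (1 - w) + w / (1 - w)))%C in C1
    by (field; exact N).
  unfold half_plane, Re in *. simpl in *. lra.
- assert (N' : (1 + w / (1 - w))%C = (/ (1 - w))%C) by (field; exact N).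
  rewrite N'. field. exact N.
Qed.

(** [|M + e|^2 - |e - M|^2 = 4 e Re M >= 0]; strictness comes from [|W| < 1] and [M + e <> 0]. *)
Lemma Cmod_reflect_lt (M W : C) (e : R) :
  0 < Re M -> 0 <= e -> unit_disk W -> Cmod (W * (RtoC e - M)) < Cmod (M + RtoC e).
Proof.
intros HM He HW. rewrite Cmod_mult.
assert (L : Cmod (RtoC e - M) <= Cmod (M + RtoC e)).
{ apply Rsqr_incr_0; try apply Cmod_ge_0. unfold Rsqr.
  assert (Q1 := Cmod2_alt (RtoC e - M)). assert (Q2 := Cmod2_alt (M + RtoC e)).
  unfold Re, Im in *. simpl in *. nra. }
assert (P : 0 < Cmod (M + RtoC e)).
{ apply Cmod_gt_0. intros E. apply (f_equal Re) in E. unfold Re in *. simpl in E. lra. }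
unfold unit_disk in HW. assert (H0 := Cmod_ge_0 W). assert (H1 := Cmod_ge_0 (RtoC e - M)).
apply Rle_lt_trans with (Cmod W * Cmod (M + RtoC e)); [apply Rmult_le_compat_l; assumption|nra].
Qed.

(** * Hadamard products with rational kernels *)

Lemma geom_conv_delta0 (q : C) (k : nat) : geom_conv q delta0 k = (q ^ k)%C.
Proof. induction k as [|k IH]; simpl; [reflexivity|rewrite IH; ring]. Qed.

Lemma geom_conv_delta0_twice (q : C) (k : nat) :
  geom_conv q (geom_conv q delta0) k = (RtoC (INR (S k)) * q ^ k)%C.
Proof.
induction k as [|k IH]; [simpl; ring|].
change (geom_conv q (geom_conv q delta0) (S k))
  with (q * geom_conv q (geom_conv q delta0) k + geom_conv q delta0 (S k))%C.
rewrite IH, geom_conv_delta0, (S_INR (S k)), RtoC_plus. simpl Cpow. ring.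
Qed.

Lemma C_PSeries_unshift (b : nat -> C) (z : C) :
  poly_bounded b -> unit_disk z ->
  C_PSeries (fun k => match k with O => RtoC 0 | S j => b j end) z = (z * C_PSeries b z)%C.
Proof.
intros Hb Hz. rewrite C_PSeries_incr.
- change (fun k => b k) with b. ring.
- apply poly_bounded_unshift. exact Hb.
- exact Hz.
Qed.

(* The first factor is the kernel with coefficients [(s + t k) A^(k-1)], so
   convolving with it yields [s psi + t z psi'] at the rotated point [A z]. *)
Lemma hadamard_kernel (A s t : C) (phi psi : C -> C) (b : nat -> C) (z : C) :
  Cmod A = 1 ->
  (forall w, unit_disk w -> phi w = (w * (s / (1 - A * w) + t / (1 - A * w) ^ 2))%C) ->
  poly_bounded b -> (forall w, unit_disk w -> psi w = C_PSeries b w) -> b O = RtoC 0 ->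
  unit_disk z ->
  (A * hadamard phi psi z = s * psi (A * z) + t * (A * z) * C_derive psi (A * z))%C.
Proof.
intros HA Hphi Hb Hpsi Hb0 Hz.
assert (HAz := unit_disk_rotate A z HA Hz).
(* Coefficients of [1 / (1 - A w)] and of [1 / (1 - A w)^2]. The factor [w] in front of the kernel
   becomes the index shift in [ck]. *)
set (k1 := geom_conv A delta0). set (k2 := geom_conv A k1).
assert (K1 : poly_bounded k1) by (apply poly_bounded_geom_conv; [exact HA|apply poly_bounded_delta0]).
assert (K2 : poly_bounded k2) by (apply poly_bounded_geom_conv; [exact HA|exact K1]).
assert (SK1 := poly_bounded_mult _ _ (poly_bounded_const s) K1).
assert (TK2 := poly_bounded_mult _ _ (poly_bounded_const t) K2).
assert (KK := poly_bounded_plus _ _ SK1 TK2). simpl in KK.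
set (kk := fun k => (s * k1 k + t * k2 k)%C).
set (ck := fun k => match k with O => RtoC 0 | S j => kk j end).
assert (CK : poly_bounded ck) by (apply poly_bounded_unshift; exact KK).
assert (Ephi : forall w, unit_disk w -> phi w = C_PSeries ck w).
{ intros w Hw. rewrite (Hphi w Hw). unfold ck.
  rewrite C_PSeries_unshift by assumption.
  unfold kk. rewrite (C_PSeries_plus (fun k => s * k1 k)%C (fun k => t * k2 k)%C) by assumption.
  rewrite !C_PSeries_scal by assumption.
  assert (N := Cminus_1_neq_0 _ (unit_disk_rotate A w HA Hw)).
  assert (E1 := C_PSeries_geom_conv A delta0 w HA poly_bounded_delta0 Hw).
  assert (E2 := C_PSeries_geom_conv A k1 w HA K1 Hw).
  rewrite C_PSeries_delta0 in E1 by exact Hw. fold k1 in E1. fold k2 in E2.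
  rewrite <- E2 in E1.
  assert (F2 : C_PSeries k2 w = (/ (1 - A * w) ^ 2)%C).
  { transitivity ((1 - A * w) * ((1 - A * w) * C_PSeries k2 w) * / (1 - A * w) ^ 2)%C;
      [simpl; field; exact N|]. rewrite E1. ring. }
  rewrite <- E2, F2. simpl. field. exact N. }
unfold hadamard.
rewrite (C_Series_ext _ (fun k => (kk k * b (S k) * z ^ S k)%C)).
2:{ intros k. rewrite (taylor_coeff_PSeries phi ck), (taylor_coeff_PSeries psi b) by assumption.
    reflexivity. }
assert (Db := poly_bounded_derive b Hb). assert (Sb := poly_bounded_shift b Hb).
assert (E0 : C_derive psi (A * z) = C_PSeries (C_PS_derive b) (A * z)).
{ apply Complex.is_C_derive_unique. apply (is_C_derive_ext_disk (C_PSeries b)); [exact HAz| |].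
  - intros w Hw. symmetry. apply Hpsi, Hw.
  - apply is_C_derive_PSeries; assumption. }
rewrite E0, (Hpsi _ HAz), (C_PSeries_incr b) by assumption. rewrite Hb0.
unfold C_PSeries.
assert (S1 := C_PSeries_summable _ _ Sb HAz).
assert (S2 := C_PSeries_summable _ _ Db HAz). simpl in S1.
(* The powers of [A] from the kernel combine with those of [z]. The first sum is [psi (A z)] divided
   by [A z], as [b O = 0], and the second is the derivative. *)
transitivity (C_Series (fun k => (A * z * s * (b (S k) * (A * z) ^ k)
  + A * z * t * (C_PS_derive b k * (A * z) ^ k))%C)).
- rewrite <- C_Series_scal.
  + apply C_Series_ext. intros k. unfold kk, k2, k1, C_PS_derive.
    rewrite geom_conv_delta0, geom_conv_delta0_twice, Cpow_mult_l.
    simpl Cpow. ring.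
  + apply (abs_summable_le _ (fun k => Cmod (kk k * b (S k)) * Cmod z ^ k)).
    * intros k. rewrite (Cmod_mult (kk k * b (S k))), Cmod_pow.
      apply Rmult_le_compat_l; [apply Cmod_ge_0|].
      unfold unit_disk in Hz. assert (Z := Cmod_ge_0 z). assert (0 <= Cmod z ^ k) by (apply pow_le, Z).
      simpl. nra.
    * apply (poly_bounded_summable (fun k => kk k * b (S k))%C).
      -- apply poly_bounded_mult; assumption.
      -- split; [apply Cmod_ge_0|exact Hz].
- rewrite C_Series_plus.
  + rewrite !C_Series_scal by assumption. ring.
  + apply (abs_summable_le _ (fun k => Cmod (A * z * s) * Cmod (b (S k) * (A * z) ^ k))).
    * intros k. rewrite (Cmod_mult (A * z * s)). lra.
    * apply (ex_series_scal_l (V := R_NormedModule)), S1.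
  + apply (abs_summable_le _ (fun k => Cmod (A * z * t) * Cmod (C_PS_derive b k * (A * z) ^ k))).
    * intros k. rewrite (Cmod_mult (A * z * t)). lra.
    * apply (ex_series_scal_l (V := R_NormedModule)), S2.
Qed.

(** The real part of [H + conj G] is that of [H + G] and its imaginary part is that of [H - G], so
    all four partial derivatives come from analytic functions. *)
Lemma wirtinger_harmonic_of (f H G : C -> C) (z p q : C) :
  (forall w, f w = harmonic_of H G w) ->
  is_C_derive H z p -> is_C_derive G z q ->
  d_z f z = p /\ d_zbar f z = Cconj q.
Proof.
intros Hf DH DG. destruct z as [x y].
destruct (differentiable_pt_lim_unique _ _ _ _ _
  (is_C_derive_re (fun w => (H w + G w)%C) x y _ (is_C_derive_plus _ _ _ _ _ DH DG))) as [X1 X2].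
destruct (differentiable_pt_lim_unique _ _ _ _ _
  (is_C_derive_im (fun w => (H w - G w)%C) x y _ (is_C_derive_minus _ _ _ _ _ DH DG))) as [Y1 Y2].
assert (E1 : partial_x f (x, y) = (Re (p + q), Im (p - q))).
{ unfold partial_x. change (Re (x, y)) with x. change (Im (x, y)) with y. rewrite <- X1, <- Y1.
  f_equal; apply Derive_ext; intros t; rewrite Hf; unfold harmonic_of, Re, Im; simpl; ring. }
assert (E2 : partial_y f (x, y) = (- Im (p + q), Re (p - q))).
{ unfold partial_y. change (Re (x, y)) with x. change (Im (x, y)) with y. rewrite <- X2, <- Y2.
  f_equal; apply Derive_ext; intros t; rewrite Hf; unfold harmonic_of, Re, Im; simpl; ring. }
unfold d_z, d_zbar. rewrite E1, E2. unfold Re, Im.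
split; apply injective_projections; simpl; field.
Qed.

(* With [w = G zeta], [W = eps zeta^n], [h1 = h'(zeta)], [X = zeta h''(zeta)], [N = n]
   and [hf = 1/2]. *)
Lemma convolution_derivatives (h1 X w W c N hf : C) :
  (1 - w)%C <> RtoC 0 -> (1 + W)%C <> RtoC 0 -> (hf + hf = 1)%C ->
  (h1 * ((1 + W) * (1 - w) ^ 2) = 1)%C ->
  (X * ((1 + W) * (1 - w) ^ 2)
    + h1 * (N * W * (1 - w) ^ 2 - (w + w) * (1 - w) * (1 + W)) = 0)%C ->
  let M := (c * ((1 + w) / (1 - w)) + c * N * hf * ((1 - W) / (1 + W)))%C in
  ((1 - w) ^ 2 * (hf * h1 + c * (h1 + X)) = (M + hf * (1 - c * N)) / (1 + W) /\
   (1 - w) ^ 2 * (hf * (W * h1) - c * (W * h1 + (N * W * h1 + W * X)))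
     = W * (hf * (1 - c * N) - M) / (1 + W))%C.
Proof.
intros Nw NW Hhf E1 E2 M.
assert (N2 : (1 + 1)%C <> RtoC 0).
{ intros E. apply (f_equal Re) in E. simpl in E. lra. }
(* The hypotheses are solved for [hf], [h1] and [X]; substitution leaves rational identities in [w],
   [W], [c], [N]. *)
assert (F0 : hf = (/ (1 + 1))%C).
{ transitivity ((hf + hf) * / (1 + 1))%C; [field; exact N2|]. rewrite Hhf. ring. }
assert (F1 : h1 = (/ ((1 + W) * (1 - w) ^ 2))%C).
{ transitivity (h1 * ((1 + W) * (1 - w) ^ 2) * / ((1 + W) * (1 - w) ^ 2))%C.
  - simpl. field. split; assumption.
  - rewrite E1. ring. }
assert (F2 : X = (- (h1 * (N * W * (1 - w) ^ 2 - (w + w) * (1 - w) * (1 + W)))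
  * / ((1 + W) * (1 - w) ^ 2))%C).
{ transitivity ((X * ((1 + W) * (1 - w) ^ 2)) * / ((1 + W) * (1 - w) ^ 2))%C.
  - simpl. field. split; assumption.
  - f_equal. rewrite <- (Cplus_0_l (- _)), <- E2. ring. }
unfold M. rewrite F2, F1, F0. split; simpl; field; repeat split; assumption.
Qed.

(** * The convolution of the theorem *)

Lemma RtoC_neq_0 (x : R) : x <> 0 -> RtoC x <> RtoC 0.
Proof. intros H E. apply H. apply (f_equal Re) in E. exact E. Qed.

Lemma RtoC_two : RtoC 2 = (1 + 1)%C.
Proof. rewrite <- RtoC_plus. f_equal. Qed.

Lemma two_neq_0 : (1 + 1)%C <> RtoC 0.
Proof. rewrite <- RtoC_two. apply RtoC_neq_0. lra. Qed.

Lemma RtoC_half : RtoC (1 / 2) = (/ (1 + 1))%C.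
Proof. rewrite RtoC_div, RtoC_two by lra. unfold Cdiv. ring. Qed.

Lemma is_C_derive_rescale (A : C) (f : C -> C) (z l : C) :
  is_C_derive f (A * z)%C l -> is_C_derive (fun w => f (A * w)%C) z (A * l)%C.
Proof.
intros H. apply (is_C_derive_comp f (fun w => (A * w)%C)); [exact H|].
assert (D := is_C_derive_scal A _ _ _ (is_C_derive_id z)).
rewrite Cmult_1_r in D. exact D.
Qed.

Lemma kernel_constant (a : R) : -1 < a ->
  RtoC ((1 - a) / (2 * (1 + a))) = ((1 - a) / ((1 + 1) * (1 + a)))%C.
Proof.
intros Ha. rewrite RtoC_div, RtoC_mult, RtoC_two, RtoC_minus, RtoC_plus by lra. reflexivity.
Qed.

(** Partial fractions: with [A = expi alpha], the numerator is [w ((1 - A w) / 2 + 1/(1+a) - 1/2)],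
    and [1/(1+a) - 1/2] is the constant [c]. For [g_a], apart from the factor [A^2], the last term
    becomes [a/(1+a) - 1/2 = - c]. *)
Lemma h_a_kernel (a alpha : R) (w : C) : -1 < a -> unit_disk w ->
  h_a a alpha w = (w * (RtoC (1 / 2) / (1 - expi alpha * w)
    + RtoC ((1 - a) / (2 * (1 + a))) / (1 - expi alpha * w) ^ 2))%C.
Proof.
intros Ha Hw. unfold h_a.
assert (N := Cminus_1_neq_0 _ (unit_disk_rotate _ w (Cmod_expi alpha) Hw)).
assert (Na : (1 + a)%C <> RtoC 0) by (rewrite <- RtoC_plus; apply RtoC_neq_0; lra).
assert (N2 := two_neq_0).
rewrite kernel_constant, RtoC_half, RtoC_plus by exact Ha. simpl. field.
repeat split; assumption.
Qed.

Lemma g_a_kernel (a alpha : R) (w : C) : -1 < a -> unit_disk w ->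
  g_a a alpha w = (w * (expi alpha * expi alpha * RtoC (1 / 2) / (1 - expi alpha * w)
    + - (expi alpha * expi alpha * RtoC ((1 - a) / (2 * (1 + a)))) / (1 - expi alpha * w) ^ 2))%C.
Proof.
intros Ha Hw. unfold g_a.
assert (N := Cminus_1_neq_0 _ (unit_disk_rotate _ w (Cmod_expi alpha) Hw)).
assert (Na : (1 + a)%C <> RtoC 0) by (rewrite <- RtoC_plus; apply RtoC_neq_0; lra).
assert (N2 := two_neq_0).
replace (3 * alpha) with (alpha + (alpha + alpha)) by ring.
replace (2 * alpha) with (alpha + alpha) by ring. rewrite !expi_plus.
rewrite kernel_constant, RtoC_half, RtoC_plus by exact Ha. simpl. field.
repeat split; assumption.
Qed.

(** Differentiate [(h + k g) (1 - G z) = z], where [k = expi (- 2 * gamma)] and [G = expi gamma],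
    then eliminate [g'] by the dilatation condition. *)
Lemma slanted_derivative (n : nat) (theta gamma : R) (h g : C -> C) (z : C) :
  slanted_half_plane n theta gamma h g -> unit_disk z ->
  (C_derive h z * ((1 + expi (- 2 * gamma) * expi theta * z ^ n)
    * (1 - expi gamma * z) ^ 2) = 1)%C.
Proof.
intros [Ah [Ag [_ [_ [Hhg Hd]]]]] Hz.
assert (Dh := C_derive_correct h z z (Ah z Hz)).
assert (Dg := C_derive_correct g z z (Ag z Hz)).
assert (N := Cminus_1_neq_0 _ (unit_disk_rotate _ z (Cmod_expi gamma) Hz)).
set (k := expi (- 2 * gamma)) in *. set (G := expi gamma) in *.
assert (D1 := is_C_derive_mult _ _ _ _ _
  (is_C_derive_plus _ _ _ _ _ Dh (is_C_derive_scal k _ _ _ Dg))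
  (is_C_derive_minus _ _ _ _ _ (is_C_derive_const 1 z) (is_C_derive_scal G _ _ _ (is_C_derive_id z)))).
simpl in D1.
assert (E : forall w, unit_disk w -> ((h w + k * g w) * (1 - G * w))%C = w).
{ intros w Hw. rewrite (Hhg w Hw). field.
  apply (Cminus_1_neq_0 (G * w)), unit_disk_rotate; [apply Cmod_expi|exact Hw]. }
assert (V := is_C_derive_eq_disk _ _ _ _ _ Hz E D1 (is_C_derive_id z)).
rewrite (Hhg z Hz), (Hd z Hz) in V.
transitivity ((1 - G * z) * ((C_derive h z + k * (expi theta * z ^ n * C_derive h z)) * (1 - G * z)
  + z / (1 - G * z) * (0 - G * 1)) + G * z)%C.
- simpl Cpow at 2. field. exact N.
- rewrite V. ring.
Qed.

Lemma dilatation_in_disk (n : nat) (theta gamma : R) (z : C) :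
  (1 <= n)%nat -> unit_disk z -> unit_disk (expi (- 2 * gamma) * expi theta * z ^ n).
Proof.
intros Hn Hz. destruct n as [|n]; [lia|].
apply unit_disk_rotate; [rewrite Cmod_mult, !Cmod_expi; ring|].
apply unit_disk_pow, Hz.
Qed.

(** [h'] is [1 / (1 + W)] divided twice by [1 - G z], so its coefficients are explicit. Those of
    [g'] follow from [h' + k g' = 1 / (1 - G z)^2], whose right-hand side has coefficients [du]. *)
Lemma slanted_power_series (n : nat) (theta gamma : R) (h g : C -> C) :
  (1 <= n)%nat -> slanted_half_plane n theta gamma h g ->
  exists dh dg : nat -> C, poly_bounded dh /\ poly_bounded dg /\
  forall z, unit_disk z -> C_derive h z = C_PSeries dh z /\ C_derive g z = C_PSeries dg z.
Proof.
intros Hn Hs.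
set (k := expi (- 2 * gamma)). set (G := expi gamma).
set (e := (k * expi theta)%C).
assert (HG : Cmod G = 1) by apply Cmod_expi.
assert (He : Cmod (- e) = 1) by (rewrite Cmod_opp; unfold e, k; rewrite Cmod_mult, !Cmod_expi; ring).
set (l := geom_lacunary n (- e)).
set (dh := geom_conv G (geom_conv G l)).
set (du := geom_conv G (geom_conv G delta0)).
assert (Pl : poly_bounded l) by (apply poly_bounded_geom_lacunary, He).
assert (P1 : poly_bounded (geom_conv G l)) by (apply poly_bounded_geom_conv; assumption).
assert (Pdh : poly_bounded dh) by (apply poly_bounded_geom_conv; assumption).
assert (P0 := poly_bounded_delta0).
assert (P2 : poly_bounded (geom_conv G delta0)) by (apply poly_bounded_geom_conv; assumption).
assert (Pdu : poly_bounded du) by (apply poly_bounded_geom_conv; assumption).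
assert (Pm := poly_bounded_mult _ _ (poly_bounded_const (- RtoC 1)) Pdh).
assert (Ps := poly_bounded_plus _ _ Pdu Pm). simpl in Pm, Ps.
assert (Pdg := poly_bounded_mult _ _ (poly_bounded_const (/ k)) Ps). simpl in Pdg.
exists dh, (fun j => / k * (du j + - RtoC 1 * dh j))%C.
split; [exact Pdh|]. split; [exact Pdg|].
intros z Hz.
assert (R1 := slanted_derivative n theta gamma h g z Hs Hz). fold k G e in R1.
assert (N1 := Cminus_1_neq_0 _ (unit_disk_rotate G z HG Hz)).
assert (N2 := Cplus_1_neq_0 _ (dilatation_in_disk n theta gamma z Hn Hz)). fold k e in N2.
assert (A1 := C_PSeries_geom_lacunary n (- e) z Hn He Hz). fold l in A1.
assert (A2 := C_PSeries_geom_conv G l z HG Pl Hz).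
assert (A3 := C_PSeries_geom_conv G _ z HG P1 Hz). fold dh in A3.
assert (B2 := C_PSeries_geom_conv G delta0 z HG P0 Hz).
assert (B3 := C_PSeries_geom_conv G _ z HG P2 Hz). fold du in B3.
rewrite C_PSeries_delta0 in B2 by exact Hz.
rewrite <- A2, <- A3 in A1. rewrite <- B3 in B2.
assert (Eh : C_derive h z = C_PSeries dh z).
{ transitivity (C_derive h z * ((1 - - e * z ^ n) * ((1 - G * z) * ((1 - G * z) * C_PSeries dh z))))%C.
  - rewrite A1. ring.
  - transitivity ((C_derive h z * ((1 + e * z ^ n) * (1 - G * z) ^ 2)) * C_PSeries dh z)%C;
      [simpl; ring|rewrite R1; ring]. }
split; [exact Eh|].
rewrite (C_PSeries_scal (/ k) (fun j => du j + - RtoC 1 * dh j)%C) by assumption.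
rewrite (C_PSeries_plus du (fun j => - RtoC 1 * dh j)%C) by assumption.
rewrite C_PSeries_scal by assumption.
rewrite <- Eh.
destruct Hs as [_ [_ [_ [_ [_ Hd]]]]]. rewrite (Hd z Hz).
assert (Nk : k <> RtoC 0) by (apply Cmod_gt_0; unfold k; rewrite Cmod_expi; lra).
transitivity (/ k * (C_derive h z * ((1 + e * z ^ n) * (1 - G * z) ^ 2) * C_PSeries du z
  + - RtoC 1 * C_derive h z))%C; [|rewrite R1; ring].
transitivity (/ k * ((C_derive h z * (1 + e * z ^ n)) * ((1 - G * z) * ((1 - G * z) * C_PSeries du z))
  + - RtoC 1 * C_derive h z))%C; [|simpl; ring].
rewrite B2. unfold e. field. exact Nk.
Qed.

Section Convolution.
Variables (n : nat) (theta alpha gamma a : R) (h g : C -> C).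
Hypotheses (Hn : (1 <= n)%nat) (Ha : (INR n - 2) / (INR n + 2) <= a < 1).
Hypothesis Hs : slanted_half_plane n theta gamma h g.

Let c : R := (1 - a) / (2 * (1 + a)).
Let HH : C -> C := hadamard (h_a a alpha) h.
Let GG : C -> C := hadamard (g_a a alpha) g.
Let T : C := expi (alpha + gamma).
Let Tb : C := expi (- (alpha + gamma)).
Let W (z : C) : C := (expi (- 2 * gamma) * expi theta * (expi alpha * z) ^ n)%C.
(** In the half-plane variable [u = T z / (1 - T z)] the first quotient is [1 + 2 u]. *)
Let M (z : C) : C := (RtoC c * ((1 + T * z) / (1 - T * z))
  + RtoC c * RtoC (INR n) * RtoC (1 / 2) * ((1 - W z) / (1 + W z)))%C.

Lemma one_le_n : 1 <= INR n.
Proof. apply (le_INR 1 n Hn). Qed.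

Lemma a_gt_m1 : -1 < a.
Proof.
assert (N := one_le_n). destruct Ha as [L _].
eapply Rlt_le_trans; [|exact L]. apply Rlt_div_r; lra.
Qed.

(** The hypothesis [a (n + 2) >= n - 2] rearranges to [(1 - a) n <= 2 (1 + a)]. *)
Lemma c_bounds : 0 < c /\ c * INR n <= 1.
Proof.
assert (N := one_le_n). assert (A := a_gt_m1). destruct Ha as [L U].
apply Rle_div_l in L; [|lra]. unfold c. split.
- apply Rdiv_lt_0_compat; lra.
- replace ((1 - a) / (2 * (1 + a)) * INR n) with ((1 - a) * INR n / (2 * (1 + a))) by (field; lra).
  apply Rle_div_l; lra.
Qed.

Lemma T_inverse : (T * Tb = 1)%C.
Proof. apply expi_opp_r. Qed.

Lemma W_in_disk (z : C) : unit_disk z -> unit_disk (W z).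
Proof.
intros Hz. apply dilatation_in_disk; [exact Hn|].
apply unit_disk_rotate; [apply Cmod_expi|exact Hz].
Qed.

Lemma part_power_series : exists bh bg : nat -> C,
  poly_bounded bh /\ poly_bounded bg /\ bh O = RtoC 0 /\ bg O = RtoC 0 /\
  (forall z, unit_disk z -> h z = C_PSeries bh z) /\
  (forall z, unit_disk z -> g z = C_PSeries bg z).
Proof.
destruct (slanted_power_series n theta gamma h g Hn Hs) as [dh [dg [Ph [Pg E]]]].
destruct Hs as [Ah [Ag [h0 [g0 _]]]].
exists (C_PS_primitive dh), (C_PS_primitive dg).
split; [apply poly_bounded_primitive, Ph|]. split; [apply poly_bounded_primitive, Pg|].
split; [reflexivity|]. split; [reflexivity|].
split; apply C_PSeries_of_derive; try assumption; intros z Hz;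
  destruct (E z Hz) as [E1 E2].
- rewrite <- E1. apply C_derive_correct; [exact z|apply Ah, Hz].
- rewrite <- E2. apply C_derive_correct; [exact z|apply Ag, Hz].
Qed.

Lemma part_formulas (z : C) : unit_disk z ->
  (expi alpha * HH z = RtoC (1 / 2) * h (expi alpha * z)
    + RtoC c * (expi alpha * z) * C_derive h (expi alpha * z))%C /\
  (expi alpha * GG z = expi alpha * expi alpha * RtoC (1 / 2) * g (expi alpha * z)
    + - (expi alpha * expi alpha * RtoC c) * (expi alpha * z) * C_derive g (expi alpha * z))%C.
Proof.
intros Hz. destruct part_power_series as [bh [bg [Ph [Pg [h0 [g0 [Eh Eg]]]]]]].
split.
- apply (hadamard_kernel _ _ _ _ _ bh); try assumption; [apply Cmod_expi|].
  intros w Hw. apply h_a_kernel; [apply a_gt_m1|exact Hw].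
- apply (hadamard_kernel _ _ _ _ _ bg); try assumption; [apply Cmod_expi|].
  intros w Hw. apply g_a_kernel; [apply a_gt_m1|exact Hw].
Qed.

(** The relations are the derivatives of [h' (1 + W) (1 - G z)^2 = 1] and of the dilatation
    identity, with [W] taken at [z] itself. Both are multiplied by [z], so that [z * n z^(n-1)] is
    again [n z^n]. *)
Lemma second_derivatives (z : C) : unit_disk z -> exists h2 g2 : C,
  is_C_derive (C_derive h) z h2 /\ is_C_derive (C_derive g) z g2 /\
  (z * h2 * ((1 + expi (- 2 * gamma) * expi theta * z ^ n) * (1 - expi gamma * z) ^ 2)
    + C_derive h z * (RtoC (INR n) * (expi (- 2 * gamma) * expi theta * z ^ n) * (1 - expi gamma * z) ^ 2
      - (expi gamma * z + expi gamma * z) * (1 - expi gamma * z)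
        * (1 + expi (- 2 * gamma) * expi theta * z ^ n)) = 0)%C /\
  (z * g2 = expi theta * z ^ n * (RtoC (INR n) * C_derive h z + z * h2))%C.
Proof.
intros Hz.
destruct (slanted_power_series n theta gamma h g Hn Hs) as [dh [dg [Ph [Pg E]]]].
set (h2 := C_PSeries (C_PS_derive dh) z).
assert (Dh : is_C_derive (C_derive h) z h2).
{ apply (is_C_derive_ext_disk (C_PSeries dh)); [exact Hz| |apply is_C_derive_PSeries; assumption].
  intros w Hw. symmetry. apply (E w Hw). }
destruct n as [|p]; [lia|].
set (k := expi (- 2 * gamma)). set (G := expi gamma). set (t := expi theta).
assert (Dp := is_C_derive_pow p z).
assert (Dg := is_C_derive_mult _ _ _ _ _ (is_C_derive_scal t _ _ _ Dp) Dh).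
cbv beta in Dg.
exists h2. eexists. split; [exact Dh|]. split; [|split].
- apply (is_C_derive_ext_disk (fun w => (t * w ^ S p * C_derive h w)%C)); [exact Hz| |exact Dg].
  intros w Hw. symmetry. destruct Hs as [_ [_ [_ [_ [_ Hd]]]]]. apply (Hd w Hw).
- assert (DW := is_C_derive_plus _ _ _ _ _ (is_C_derive_const 1 z) (is_C_derive_scal (k * t) _ _ _ Dp)).
  assert (DG := is_C_derive_minus _ _ _ _ _ (is_C_derive_const 1 z) (is_C_derive_scal G _ _ _ (is_C_derive_id z))).
  assert (D1 := is_C_derive_mult _ _ _ _ _ Dh
    (is_C_derive_mult _ _ _ _ _ DW (is_C_derive_mult _ _ _ _ _ DG DG))).
  assert (E1 : forall w, unit_disk w -> (C_derive h w * ((1 + k * t * w ^ S p) * ((1 - G * w) * (1 - G * w))))%C = RtoC 1).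
  { intros w Hw. etransitivity; [|exact (slanted_derivative _ _ _ _ _ _ Hs Hw)].
    fold k G t. ring. }
  assert (V := is_C_derive_eq_disk _ _ _ _ _ Hz E1 D1 (is_C_derive_const 1 z)).
  rewrite <- (Cmult_0_r z), <- V.
  change (z ^ S p)%C with (z * z ^ p)%C. change ((1 - G * z) ^ 2)%C with ((1 - G * z) * ((1 - G * z) * 1))%C. ring.
- change (z ^ S p)%C with (z * z ^ p)%C. ring.
Qed.

(** The factors multiplying [p] and [q] are those of the rotation and of the change of variable
    [z |-> u], so the left-hand sides are the derivatives in [u]. *)
Lemma part_derivatives (z : C) : unit_disk z -> exists p q : C,
  is_C_derive HH z p /\ is_C_derive GG z q /\
  ((1 - T * z) ^ 2 * p = (M z + RtoC (1 / 2) * (1 - RtoC c * RtoC (INR n))) / (1 + W z))%C /\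
  (Tb ^ 2 * (1 - T * z) ^ 2 * q = W z * (RtoC (1 / 2) * (1 - RtoC c * RtoC (INR n)) - M z) / (1 + W z))%C.
Proof.
intros Hz.
set (A := expi alpha). set (x := (A * z)%C).
assert (HA : Cmod A = 1) by apply Cmod_expi.
assert (NA : A <> RtoC 0) by (apply Cmod_gt_0; lra).
assert (Hx : unit_disk x) by (apply unit_disk_rotate; assumption).
destruct (second_derivatives x Hx) as [h2 [g2 [Dh2 [Dg2 [R2 R3]]]]].
assert (R1 := slanted_derivative n theta gamma h g x Hs Hx).
assert (Dh1 : is_C_derive h x (C_derive h x)) by (apply C_derive_correct; [exact z|apply Hs, Hx]).
assert (Dg1 : is_C_derive g x (C_derive g x)) by (apply C_derive_correct; [exact z|apply Hs, Hx]).
assert (R0 : C_derive g x = (expi theta * x ^ n * C_derive h x)%C) by (apply Hs, Hx).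
set (h1 := C_derive h x) in *. set (g1 := C_derive g x) in *.
assert (DA := is_C_derive_scal A _ _ _ (is_C_derive_id z)).
assert (Ew : (expi gamma * x = T * z)%C) by (unfold x, T, A; rewrite expi_plus; ring).
rewrite !Ew in R1. rewrite !Ew in R2.
change (expi (- 2 * gamma) * expi theta * x ^ n)%C with (W z) in R1, R2.
assert (Nw : (1 - T * z)%C <> RtoC 0) by (apply Cminus_1_neq_0, unit_disk_rotate; [apply Cmod_expi|exact Hz]).
assert (NW : (1 + W z)%C <> RtoC 0) by (apply Cplus_1_neq_0, W_in_disk, Hz).
assert (Hhf : (RtoC (1 / 2) + RtoC (1 / 2) = 1)%C) by (rewrite <- RtoC_plus; f_equal; lra).
destruct (convolution_derivatives h1 (x * h2) (T * z) (W z) (RtoC c) (RtoC (INR n)) (RtoC (1 / 2))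
  Nw NW Hhf R1 R2) as [F1 F2].
exists (RtoC (1 / 2) * h1 + RtoC c * (h1 + x * h2))%C,
  (A * A * (RtoC (1 / 2) * g1 - RtoC c * (g1 + x * g2)))%C.
split; [|split; [|split]].
- apply (is_C_derive_ext_disk (fun w => / A * (RtoC (1 / 2) * h (A * w)
    + RtoC c * ((A * w) * C_derive h (A * w))))%C); [exact Hz| |].
  + intros w Hw. destruct (part_formulas w Hw) as [E _].
    transitivity (/ A * (A * HH w))%C; [unfold A at 6; rewrite E; unfold A; ring|field; exact NA].
  + assert (D := is_C_derive_scal (/ A) _ _ _ (is_C_derive_plus _ _ _ _ _
      (is_C_derive_scal (RtoC (1 / 2)) _ _ _ (is_C_derive_rescale A h z _ Dh1))
      (is_C_derive_scal (RtoC c) _ _ _ (is_C_derive_mult _ _ _ _ _ DA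
         (is_C_derive_rescale A (C_derive h) z _ Dh2))))).
    simpl in D.
    replace (RtoC (1 / 2) * h1 + RtoC c * (h1 + x * h2))%C
      with (/ A * (RtoC (1 / 2) * (A * h1) + RtoC c * (A * 1 * C_derive h (A * z) + A * z * (A * h2))))%C;
      [exact D|].
    fold x. fold h1. unfold x. field. exact NA.
- apply (is_C_derive_ext_disk (fun w => A * (RtoC (1 / 2) * g (A * w)
    - RtoC c * ((A * w) * C_derive g (A * w))))%C); [exact Hz| |].
  + intros w Hw. destruct (part_formulas w Hw) as [_ E]. fold A in E.
    transitivity (/ A * (A * GG w))%C; [rewrite E|]; field; exact NA.
  + assert (D := is_C_derive_scal A _ _ _ (is_C_derive_minus _ _ _ _ _
      (is_C_derive_scal (RtoC (1 / 2)) _ _ _ (is_C_derive_rescale A g z _ Dg1))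
      (is_C_derive_scal (RtoC c) _ _ _ (is_C_derive_mult _ _ _ _ _ DA
         (is_C_derive_rescale A (C_derive g) z _ Dg2))))).
    simpl in D.
    replace (A * A * (RtoC (1 / 2) * g1 - RtoC c * (g1 + x * g2)))%C
      with (A * (RtoC (1 / 2) * (A * g1) - RtoC c * (A * 1 * C_derive g (A * z) + A * z * (A * g2))))%C;
      [exact D|].
    fold x. fold g1. unfold x. ring.
- exact F1.
- unfold M. rewrite <- F2.
  (* This unimodular factor turns the dilatation [expi theta * x ^ n] into [W z]. *)
  assert (ET : (Tb ^ 2 * (A * A) = expi (- 2 * gamma))%C).
  { unfold Tb, A. simpl Cpow. rewrite Cmult_1_r, <- !expi_plus. f_equal. ring. }
  transitivity ((1 - T * z) ^ 2 * ((Tb ^ 2 * (A * A)) * (RtoC (1 / 2) * g1 - RtoC c * (g1 + x * g2))))%C; [ring|].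
  rewrite ET, R3, R0. unfold W. fold A. fold x. ring.
Qed.

Lemma M_re (z : C) : unit_disk z -> 0 < Re (M z).
Proof.
intros Hz. destruct c_bounds as [c0 _]. assert (N := one_le_n).
assert (C1 := Re_cayley_pos _ (unit_disk_opp _ (unit_disk_rotate T z (Cmod_expi _) Hz))).
replace ((1 - - (T * z)) / (1 + - (T * z)))%C with ((1 + T * z) / (1 - T * z))%C in C1
  by (unfold Cdiv, Cminus; f_equal; ring).
assert (C2 := Re_cayley_pos _ (W_in_disk z Hz)).
unfold M. rewrite <- !RtoC_mult. rewrite re_plus, !re_scal_l.
apply Rplus_lt_0_compat; apply Rmult_lt_0_compat; try assumption.
apply Rmult_lt_0_compat; [apply Rmult_lt_0_compat|]; lra.
Qed.

Lemma half_excess : 0 <= 1 / 2 * (1 - c * INR n) /\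
  (RtoC (1 / 2) * (1 - RtoC c * RtoC (INR n)))%C = RtoC (1 / 2 * (1 - c * INR n)).
Proof.
destruct c_bounds as [_ c1]. split; [lra|].
rewrite <- RtoC_mult, <- RtoC_minus, <- RtoC_mult. reflexivity.
Qed.

(** The moduli of [(1 - T z)^2] and [1 + W z] cancel, [|Tb| = 1], and [Cmod_reflect_lt] applies with
    [e = (1 - c n) / 2]. *)
Lemma part_jacobian (z p q : C) : unit_disk z ->
  is_C_derive HH z p -> is_C_derive GG z q -> Cmod q < Cmod p.
Proof.
intros Hz Dp Dq. destruct (part_derivatives z Hz) as [p' [q' [Dp' [Dq' [E1 E2]]]]].
assert (p = p') by (rewrite <- (Complex.is_C_derive_unique _ _ _ Dp); apply Complex.is_C_derive_unique, Dp').
assert (q = q') by (rewrite <- (Complex.is_C_derive_unique _ _ _ Dq); apply Complex.is_C_derive_unique, Dq').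
subst p' q'.
assert (Nw : (1 - T * z)%C <> RtoC 0) by (apply Cminus_1_neq_0, unit_disk_rotate; [apply Cmod_expi|exact Hz]).
assert (NW : (1 + W z)%C <> RtoC 0) by (apply Cplus_1_neq_0, W_in_disk, Hz).
destruct half_excess as [e0 Ee]. rewrite Ee in E1, E2.
assert (L := Cmod_reflect_lt (M z) (W z) _ (M_re z Hz) e0 (W_in_disk z Hz)).
apply (f_equal Cmod) in E1, E2.
rewrite Cmod_mult, Cmod_div, Cmod_pow in E1 by exact NW.
rewrite !Cmod_mult, Cmod_div, !Cmod_pow in E2 by exact NW.
unfold Tb in E2. rewrite Cmod_expi, pow1, Rmult_1_l in E2.
assert (D : 0 < Cmod (1 - T * z) ^ 2) by (apply pow_lt, Cmod_gt_0, Nw).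
apply Rmult_lt_reg_l with (Cmod (1 - T * z) ^ 2); [exact D|].
rewrite E1, E2. apply Rmult_lt_compat_r; [|exact L].
apply Rinv_0_lt_compat, Cmod_gt_0, NW.
Qed.

(** * The convolution in the half-plane variable *)

(** Multiplying the map by [T] makes the direction [- (alpha + gamma)] horizontal. On the
    co-analytic part this is multiplication by the conjugate [Tb] before conjugation. *)
Let H1 (u : C) : C := (T * HH (Tb * (u / (1 + u))))%C.
Let G1 (u : C) : C := (Tb * GG (Tb * (u / (1 + u))))%C.

Lemma half_plane_model (z u : C) : z = (Tb * (u / (1 + u)))%C ->
  (T * harmonic_of HH GG z)%C = harmonic_of H1 G1 u.
Proof.
intros ->. unfold harmonic_of, H1, G1. rewrite Cmult_conj.
replace (Cconj Tb) with T; [ring|].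
unfold Tb. rewrite Cconj_expi, Ropp_involutive. reflexivity.
Qed.

Lemma is_C_derive_moebius (u : C) : (1 + u)%C <> RtoC 0 ->
  is_C_derive (fun v => (Tb * (v / (1 + v)))%C) u (Tb * (/ (1 + u)) ^ 2)%C.
Proof.
intros N.
assert (D := is_C_derive_plus _ _ _ _ _ (is_C_derive_const 1 u) (is_C_derive_id u)).
assert (D' := is_C_derive_comp Cinv (fun v => (1 + v)%C) u _ _ (is_C_derive_inv _ N) D).
assert (D2 := is_C_derive_scal Tb _ _ _ (is_C_derive_mult _ _ _ _ _ (is_C_derive_id u) D')).
simpl in D2.
replace (Tb * (/ (1 + u)) ^ 2)%C
  with (Tb * (1 * / (1 + u) + u * ((0 + 1) * - / ((1 + u) * (1 + u)))))%C; [exact D2|].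
simpl. field. exact N.
Qed.

Lemma half_plane_parts (u : C) : half_plane (- (1 / 2)) u -> exists p q : C,
  is_C_derive H1 u p /\ is_C_derive G1 u q /\ Cmod q < Cmod p /\
  c * (1 + 2 * Re u) <= Re (p - q).
Proof.
intros Hu. destruct (half_plane_to_disk u Hu) as [N Hw].
set (z := (Tb * (u / (1 + u)))%C).
assert (Hz : unit_disk z) by (apply unit_disk_rotate; [apply Cmod_expi|exact Hw]).
assert (TT := T_inverse).
assert (Ew : (T * z = u / (1 + u))%C).
{ unfold z. rewrite Cmult_assoc, TT. ring. }
assert (E1w : (1 - T * z = / (1 + u))%C) by (rewrite Ew; field; exact N).
destruct (part_derivatives z Hz) as [p [q [Dp [Dq [E1 E2]]]]].
assert (Lpq := part_jacobian z p q Hz Dp Dq).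
assert (Dm := is_C_derive_moebius u N).
assert (DP := is_C_derive_scal T _ _ _ (is_C_derive_comp HH (fun v => Tb * (v / (1 + v)))%C u _ _ Dp Dm)).
assert (DQ := is_C_derive_scal Tb _ _ _ (is_C_derive_comp GG (fun v => Tb * (v / (1 + v)))%C u _ _ Dq Dm)).
assert (F1 : (T * (Tb * (/ (1 + u)) ^ 2 * p) = (1 - T * z) ^ 2 * p)%C).
{ rewrite E1w. transitivity ((T * Tb) * (/ (1 + u)) ^ 2 * p)%C; [ring|]. rewrite TT. ring. }
assert (F2 : (Tb * (Tb * (/ (1 + u)) ^ 2 * q) = Tb ^ 2 * (1 - T * z) ^ 2 * q)%C).
{ rewrite E1w. simpl. ring. }
exists ((1 - T * z) ^ 2 * p)%C, (Tb ^ 2 * (1 - T * z) ^ 2 * q)%C.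
split; [rewrite <- F1; exact DP|]. split; [rewrite <- F2; exact DQ|]. split.
- rewrite !Cmod_mult, !Cmod_pow. unfold Tb at 1. rewrite Cmod_expi, pow1, Rmult_1_l.
  apply Rmult_lt_compat_l; [|exact Lpq].
  apply pow_lt, Cmod_gt_0. rewrite E1w. intros E.
  assert (Q : ((1 + u) * / (1 + u))%C = RtoC 1) by (apply Cinv_r, N).
  rewrite E, Cmult_0_r in Q. apply (f_equal Re) in Q. simpl in Q. lra.
- assert (NW : (1 + W z)%C <> RtoC 0) by (apply Cplus_1_neq_0, W_in_disk, Hz).
  assert (Hhf : (RtoC (1 / 2) + RtoC (1 / 2) = 1)%C) by (rewrite <- RtoC_plus; f_equal; lra).
  rewrite E1, E2.
  (* The multiples of [c n] contributed by [M] and by [e] cancel, leaving coefficient 1/2 on a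
     Cayley transform of positive real part. *)
  assert (EE : ((M z + RtoC (1 / 2) * (1 - RtoC c * RtoC (INR n))) / (1 + W z)
     - W z * (RtoC (1 / 2) * (1 - RtoC c * RtoC (INR n)) - M z) / (1 + W z)
     = RtoC c * (1 + (u + u)) + RtoC (1 / 2) * ((1 - W z) / (1 + W z)))%C).
  { replace (1 + (u + u))%C with ((1 + T * z) / (1 - T * z))%C.
    - unfold M. field. split; [exact NW|].
      apply Cminus_1_neq_0, unit_disk_rotate; [apply Cmod_expi|exact Hz].
    - rewrite Ew. field. split; [exact N|].
      replace (1 + u - u)%C with (RtoC 1) by ring. apply RtoC_neq_0. lra. }
  rewrite EE, re_plus, !re_scal_l.
  assert (C2 := Re_cayley_pos _ (W_in_disk z Hz)).
  replace (Re (1 + (u + u))) with (1 + 2 * Re u) by (unfold Re; simpl; ring).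
  lra.
Qed.

Lemma half_plane_data : exists P Q : C -> C,
  (forall u, half_plane (- (1 / 2)) u -> is_C_derive H1 u (P u)) /\
  (forall u, half_plane (- (1 / 2)) u -> is_C_derive G1 u (Q u)) /\
  (forall u, half_plane (- (1 / 2)) u -> c * (1 + 2 * Re u) <= Re (P u - Q u)) /\
  (forall u, half_plane (- (1 / 2)) u -> Cmod (Q u) < Cmod (P u)).
Proof.
(* The derivatives [p], [q] exist pointwise; [C_derive] assembles them into functions without
   choice. *)
exists (C_derive H1), (C_derive G1).
split; [|split; [|split]]; intros u Hu; destruct (half_plane_parts u Hu) as [p [q [Dp [Dq [L S]]]]];
  rewrite ?(Complex.is_C_derive_unique _ _ _ Dp), ?(Complex.is_C_derive_unique _ _ _ Dq); assumption.
Qed.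

Lemma disk_coordinate (z : C) : unit_disk z -> exists u,
  half_plane (- (1 / 2)) u /\ z = (Tb * (u / (1 + u)))%C.
Proof.
intros Hz.
destruct (disk_to_half_plane (T * z) (unit_disk_rotate T z (Cmod_expi _) Hz)) as [Hu E].
exists (T * z / (1 - T * z))%C. split; [exact Hu|].
rewrite E, Cmult_assoc, (Cmult_comm Tb), T_inverse. ring.
Qed.

Lemma m_pos : forall x, - (1 / 2) < x -> 0 < c * (1 + 2 * x).
Proof. intros x Hx. apply Rmult_lt_0_compat; [apply c_bounds|lra]. Qed.

Lemma m_cont : forall x, - (1 / 2) < x -> continuity_pt (fun t => c * (1 + 2 * t)) x.
Proof. intros x _. reg. Qed.

Lemma T_cancel (z w : C) : (T * z = T * w)%C -> z = w.
Proof.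
intros E. replace z with (Tb * (T * z))%C; [rewrite E|];
  rewrite Cmult_assoc, (Cmult_comm Tb), T_inverse; ring.
Qed.

Lemma convolution_univalent : univalent (harmonic_of HH GG).
Proof.
intros z w Hz Hw E.
destruct (disk_coordinate z Hz) as [u [Hu Ez]]. destruct (disk_coordinate w Hw) as [v [Hv Ew]].
destruct half_plane_data as [P [Q [DH [DG [S J]]]]].
assert (u = v); [|subst v; congruence].
apply (half_plane_injective _ (fun x => c * (1 + 2 * x)) H1 G1 P Q DH DG m_pos m_cont S J u v Hu Hv).
rewrite <- (half_plane_model z u Ez), <- (half_plane_model w v Ew), E. reflexivity.
Qed.

Lemma convolution_convex : convex_in_direction (- (alpha + gamma)) (harmonic_of HH GG).
Proof.
intros w0.
destruct half_plane_data as [P [Q [DH [DG [S J]]]]].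
set (s := Im (T * w0)).
destruct (half_plane_slice _ (fun x => c * (1 + 2 * x)) H1 G1 P Q DH DG m_pos m_cont S J s) as [r [Hc Hr]].
assert (TT := T_inverse).
(* Rotation by [T] sends the line through [w0] to the horizontal line at height [s]; the base point
   and direction here are [i s] and 1 rotated back. *)
apply (connected_curve_in_line _ r (- (1 / 2)) (Tb * (Ci * RtoC s)) Tb); [|exact Hc].
assert (Split : forall t, (t, s) = (RtoC t + Ci * RtoC s)%C)
  by (intros t; apply injective_projections; simpl; ring).
intros y. unfold line. fold Tb. split.
- intros [[z [Hz Ey]] [t Et]].
  destruct (disk_coordinate z Hz) as [u [Hu Ez]].
  assert (Q1 := half_plane_model z u Ez). rewrite Ey in Q1.
  assert (Im1 : Im (T * y) = s).
  { rewrite Et. replace (T * (w0 + RtoC t * Tb))%C with (T * w0 + RtoC t * (T * Tb))%C by ring.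
    rewrite TT. unfold s, Im. simpl. ring. }
  assert (X : exists x, - (1 / 2) < x /\ Re (T * y) = r x).
  { apply Hr. exists u. split; [exact Hu|]. rewrite <- Q1, <- Im1. apply surjective_pairing. }
  destruct X as [x [Hx Ex]]. exists x. split; [exact Hx|].
  apply T_cancel. transitivity (RtoC (r x) + Ci * RtoC s)%C.
  + rewrite <- Split, <- Ex, <- Im1. apply surjective_pairing.
  + transitivity ((T * Tb) * (RtoC (r x) + Ci * RtoC s))%C; [rewrite TT|]; ring.
- intros [x [Hx Ey]].
  destruct (proj2 (Hr (r x)) (ex_intro _ x (conj Hx eq_refl))) as [u [Hu Eu]].
  destruct (half_plane_to_disk u Hu) as [N Hw].
  assert (Q1 := half_plane_model _ u eq_refl).
  assert (Ty : (T * y = (r x, s))%C).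
  { rewrite Ey, Split. transitivity ((T * Tb) * (RtoC (r x) + Ci * RtoC s))%C; [|rewrite TT]; ring. }
  split.
  + exists (Tb * (u / (1 + u)))%C. split.
    * apply unit_disk_rotate; [apply Cmod_expi|exact Hw].
    * apply T_cancel. rewrite Q1, Eu, Ty. reflexivity.
  + exists (r x - Re (T * w0)). apply T_cancel. rewrite Ty.
    transitivity (T * w0 + RtoC (r x - Re (T * w0)) * (T * Tb))%C; [|ring].
    rewrite TT. apply injective_projections; [|unfold s]; unfold Re, Im; simpl; ring.
Qed.

Lemma convolution_S_H0 : S_H0 (fun z => (RtoC (1 + a) * harmonic_of HH GG z)%C).
Proof.
assert (Na := a_gt_m1). assert (N1 : RtoC (1 + a) <> RtoC 0) by (apply RtoC_neq_0; lra).
set (k := RtoC (1 + a)) in *.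
set (f := fun z => (k * harmonic_of HH GG z)%C).
set (Hk := fun z => (k * HH z)%C). set (Gk := fun z => (k * GG z)%C).
assert (Ef : forall w, f w = harmonic_of Hk Gk w).
{ intros w. unfold f, Hk, Gk, harmonic_of. rewrite Cmult_conj.
  replace (Cconj k) with k by (unfold k; apply injective_projections; simpl; ring). ring. }
assert (Wd : forall z p q, is_C_derive HH z p -> is_C_derive GG z q ->
  d_z f z = (k * p)%C /\ d_zbar f z = Cconj (k * q)).
{ intros z p q Dp Dq. apply (wirtinger_harmonic_of f Hk Gk); [exact Ef| |];
  apply is_C_derive_scal; assumption. }
assert (U0 := unit_disk_0).
destruct (part_derivatives (RtoC 0) U0) as [p [q [Dp [Dq [E1 E2]]]]].
assert (W0 : W (RtoC 0) = RtoC 0).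
{ unfold W. destruct n as [|j]; [lia|]. simpl. ring. }
(* At 0, where [W] vanishes, [p = c + c n / 2 + (1 - c n) / 2 = c + 1/2 = 1 / (1 + a)]. *)
assert (P0 : (k * p)%C = RtoC 1).
{ unfold M in E1. rewrite W0, !Cmult_0_r in E1.
  transitivity (k * ((1 - 0) ^ 2 * p))%C; [simpl; ring|]. rewrite E1.
  unfold k, c. rewrite kernel_constant, RtoC_half, RtoC_plus by exact Na.
  assert (N2 := two_neq_0). unfold k in N1. rewrite RtoC_plus in N1.
  field. exact N1. }
assert (Q0 : q = RtoC 0).
{ rewrite W0, !Cmult_0_r in E2.
  assert (TT := T_inverse).
  transitivity (T ^ 2 * (Tb ^ 2 * (1 - 0) ^ 2 * q))%C.
  - transitivity ((T * Tb) * (T * Tb) * q)%C; [rewrite TT|simpl]; ring.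
  - rewrite E2. unfold Cdiv. ring. }
destruct (Wd _ _ _ Dp Dq) as [W1 W2].
split; [split; [|split; [|split; [|split]]]|].
- exists Hk, Gk. split; [|split].
  + intros z Hz. destruct (part_derivatives z Hz) as [p' [q' [Dp' [Dq' _]]]].
    exists (k * p')%C. apply is_C_derive_scal, Dp'.
  + intros z Hz. destruct (part_derivatives z Hz) as [p' [q' [Dp' [Dq' _]]]].
    exists (k * q')%C. apply is_C_derive_scal, Dq'.
  + intros z _. apply Ef.
- intros z Hz. destruct (part_derivatives z Hz) as [p' [q' [Dp' [Dq' _]]]].
  assert (L := part_jacobian z p' q' Hz Dp' Dq').
  destruct (Wd _ _ _ Dp' Dq') as [-> ->].
  rewrite Cmod_conj, !Cmod_mult.
  assert (K0 : 0 < Cmod k) by (apply Cmod_gt_0, N1). assert (Q1 := Cmod_ge_0 q').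
  assert (Cmod k * Cmod q' < Cmod k * Cmod p') by (apply Rmult_lt_compat_l; assumption).
  assert (0 <= Cmod k * Cmod q') by (apply Rmult_le_pos; lra). simpl. nra.
- intros z w Hz Hw E. apply convolution_univalent; try assumption.
  transitivity (/ k * f z)%C; [unfold f; field; exact N1|].
  transitivity (/ k * f w)%C; [f_equal; exact E|unfold f; field; exact N1].
- destruct (part_formulas (RtoC 0) U0) as [F1 F2].
  destruct Hs as [_ [_ [h0 [g0 _]]]].
  rewrite !Cmult_0_r, h0 in F1. rewrite !Cmult_0_r, g0 in F2.
  assert (NA : expi alpha <> RtoC 0) by (apply Cmod_gt_0; rewrite Cmod_expi; lra).
  assert (Z : forall x, (expi alpha * x)%C = RtoC 0 -> x = RtoC 0).
  { intros x E. transitivity (/ expi alpha * (expi alpha * x))%C; [field; exact NA|].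
    rewrite E. ring. }
  assert (HH0 : HH (RtoC 0) = RtoC 0) by (apply Z; rewrite F1; ring).
  assert (GG0 : GG (RtoC 0) = RtoC 0) by (apply Z; rewrite F2; ring).
  change (f (RtoC 0) = RtoC 0). unfold f, harmonic_of. rewrite HH0, GG0. apply injective_projections; simpl; ring.
- rewrite <- P0. exact W1.
- change (d_zbar f (RtoC 0) = RtoC 0). rewrite W2, Q0, Cmult_0_r. apply injective_projections; simpl; ring.
Qed.
End Convolution.

(* The z-derivative of the convolution at 0 is 1 / (1 + a), so membership in
   S_H^0, which requires the value 1, is stated for the positive multiple
   (1 + a) (f_{a,alpha} * f_gamma). *)
Theorem theorem2p2 :
  forall (n : nat) (theta alpha gamma a : R) (h g : C -> C),
    (1 <= n)%nat ->
    0 <= alpha < 2 * PI ->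
    0 <= gamma < 2 * PI ->
    (INR n - 2) / (INR n + 2) <= a < 1 ->
    slanted_half_plane n theta gamma h g ->
    let F := harmonic_conv (h_a a alpha) (g_a a alpha) h g in
    S_H0 (fun z : C => (RtoC (1 + a) * F z)%C) /\
    convex_in_direction (- (alpha + gamma)) F.
Proof.
intros n theta alpha gamma a h g Hn _ _ Ha Hs F. split.
- exact (convolution_S_H0 n theta alpha gamma a h g Hn Ha Hs).
- exact (convolution_convex n theta alpha gamma a h g Hn Ha Hs).
Qed.
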